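(* Let $\mathbb{V}_\delta:=\mathrm{span}_{\mathbb{C}}(R_{\Delta t}\otimes Z_h)$ and $\mathbb{U}_\delta:=S^*(\mathbb{V}_\delta)$. Then $$\beta_\delta:=\inf_{0\ne u_\delta\in\mathbb{U}_\delta}\ \sup_{0\ne v_\delta\in\mathbb{V}_\delta}\frac{|b(u_\delta,v_\delta)|}{\|u_\delta\|_{\mathbb{U}}\,\|v_\delta\|_{\mathbb{V}}}=1.$$ In particular, for $g\in\mathbb{V}'$ the Petrov–Galerkin problem: find $u_\delta\in\mathbb{U}_\delta$ such that $b(u_\delta,v_\delta)=g(v_\delta)$ for all $v_\delta\in\mathbb{V}_\delta$, admits a unique solution $u_\delta\in\mathbb{U}_\delta$.
   Context: Let $I=(0,T)$, $T>0$, let $\Omega\subsetneq\mathbb{R}^{3N}$ ($N\ge1$) be a bounded domain with smooth boundary $\Gamma$, and $\Omega_T=I\times\Omega$. Put $H=L_2(\Omega;\mathbb{C})$ and $\mathbb{U}:=L_2(I;H)$; inner products are linear in the first and antilinear in the second argument. $\mathcal{V}\in L_\infty(\Omega_T;\mathbb{R})$ is a real-valued potential and $S^*_\circ v:=\mathrm{i}\,\partial_t v+\tfrac12\Delta_x v-\mathcal{V}v$, with domain $D(S_\circ^* )=[C^1(I;\mathbb{C})\cap C_{\{T\}}(\bar I;\mathbb{C})]\otimes[C^2(\Omega;\mathbb{C})\cap C_0(\bar\Omega;\mathbb{C})]$, i.e. functions continuous on $\overline{\Omega_T}$, once continuously differentiable in $t\in I$, twice continuously differentiable in $x\in\Omega$,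 with $v(T,\cdot)=0$, $v=0$ on $I\times\Gamma$ and $S_\circ^*v\in\mathbb{U}$. $\mathbb{V}\subset\mathbb{U}$ is the closure (completion) of $D(S_\circ^* )$ in the norm $\|v\|_{\mathbb{V}}:=\|S_\circ^*v\|_{\mathbb{U}}$, a Hilbert space with $\|v\|_{\mathbb{V}}=\|S^*v\|_{\mathbb{U}}$, where $S^*$ is the continuous extension of $S_\circ^*$ to $\mathbb{V}$. $\mathbb{V}'$ denotes bounded antilinear functionals on $\mathbb{V}$. The sesquilinear form is $b(u,v):=(u,S^*v)_{\mathbb{U}}$ on $\mathbb{U}\times\mathbb{V}$. Discretization, $\delta=(\Delta t,h)$: $R_{\Delta t}=\mathrm{span}\{\varrho^1,\dots,\varrho^{N_t}\}\subset H^1_{\{T\}}(I;\mathbb{R}):=\{\theta\in H^1(I;\mathbb{R}):\theta(T)=0\}$ is a finite-dimensional space of splines on a uniform temporal mesh of width $\Delta t=T/N_t$, and $Z_h=\mathrm{span}\{\phi_1,\dots,\phi_{N_h}\}\subset H_0^1(\Omega;\mathbb{R})\cap H^2(\Omega;\mathbb{R})$ is a conforming finite element space. Thus $\mathbb{V}_\delta\subset\mathbb{V}_\circ:=H^1_{\{T\}}(I;\mathbb{C})\otimes[H_0^1(\Omega;\mathbb{C})\cap H^2(\Omega;\mathbb{C})]\subset\mathbb{V}$ has dimension $N_tN_h$. *)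

(* Defs.v *)
From HB Require Import structures.
From mathcomp Require Import all_boot all_order all_algebra.
From mathcomp Require Import all_classical all_reals all_analysis.
From mathcomp Require Import complex.

Set Implicit Arguments.
Unset Strict Implicit.
Unset Printing Implicit Defensive.

Import Order.TTheory GRing.Theory Num.Theory.
Import numFieldNormedType.Exports.

Local Open Scope classical_set_scope.
Local Open Scope ring_scope.

Local Notation Re := complex.Re.
Local Notation Im := complex.Im.
Local Notation normc := Normc.normc.

Section rV_measurable.
Context (R : realType) (n : nat).

Let coor (i : 'I_n) (x : 'rV[R]_n) : measurableTypeR R := x 0 i.

Let rV_set0 : g_sigma_preimage coor set0.
Proof. exact: sigma_algebra0. Qed.

Let rV_setC A : g_sigma_preimage coor A -> g_sigma_preimage coor (~` A).
Proof. exact: sigma_algebraC. Qed.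

Let rV_bigcup (F : (set 'rV[R]_n)^nat) :
  (forall i, g_sigma_preimage coor (F i)) ->
  g_sigma_preimage coor (\bigcup_i (F i)).
Proof. exact: sigma_algebra_bigcup. Qed.

HB.instance Definition _ := @isMeasurable.Build default_measure_display
  'rV[R]_n (g_sigma_preimage coor) rV_set0 rV_setC rV_bigcup.

Lemma measurable_coor (i : 'I_n) : measurable_fun [set: 'rV[R]_n] (coor i).
Proof.
move=> _ Y mY; rewrite setTI; apply: sub_sigma_algebra => /=.
rewrite -bigcup_seq/=; exists i => /=; first by rewrite mem_index_enum.
by exists Y => //; rewrite setTI.
Qed.

Lemma measurable_fun_coorP d (T : measurableType d) (f : T -> 'rV[R]_n) :
  (forall i, measurable_fun [set: T] (fun x => coor i (f x))) ->
  measurable_fun [set: T] f.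
Proof.
move=> mf _ A mA; rewrite setTI.
pose G := image_set_system setT f measurable.
suff : G A by rewrite /G /image_set_system/= setTI.
move: A mA; apply: smallest_sub.
  by apply: sigma_algebra_image; exact: sigma_algebra_measurable.
rewrite -bigcup_seq/=; apply: bigcup_sub => i _ _ [Y mY <-].
by rewrite /G /image_set_system/= !setTI -[X in measurable X]setTI; exact: mf.
Qed.

End rV_measurable.

Section lebesgue_rV.
Context (R : realType).

Definition consrV n (p : measurableTypeR R * 'rV[R]_n) : 'rV[R]_n.+1 :=
  \row_i oapp (fun j => p.2 0 j) p.1 (unlift ord0 i).

Definition unconsrV n (x : 'rV[R]_n.+1) : measurableTypeR R * 'rV[R]_n :=
  (x 0 ord0, \row_j x 0 (lift ord0 j)).

Lemma unconsrVK n : cancel (@unconsrV n) (@consrV n).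
Proof.
move=> x; apply/rowP => i; rewrite !mxE; case: unliftP => [j|] -> //=.
by rewrite mxE.
Qed.

Lemma consrVK n : cancel (@consrV n) (@unconsrV n).
Proof.
move=> [a x]; rewrite /unconsrV; congr pair; first by rewrite mxE unlift_none.
by apply/rowP => j; rewrite !mxE liftK.
Qed.

Lemma measurable_consrV n : measurable_fun setT (@consrV n).
Proof.
apply: measurable_fun_coorP => i.
rewrite (_ : (fun _ => _) =
    fun p : measurableTypeR R * 'rV[R]_n =>
      oapp (fun j => p.2 0 j) p.1 (unlift ord0 i)); last first.
  by apply/funext => p; rewrite mxE.
case: unliftP => [j|] _ /=; last exact: measurable_fst.
apply: (@measurableT_comp _ _ _ _ _ _ (fun x : 'rV[R]_n => x 0 j)) => //.
exact: measurable_coor.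
Qed.

Lemma measurable_unconsrV n : measurable_fun setT (@unconsrV n).
Proof.
apply/measurable_fun_pairP; split; first exact: measurable_coor.
apply: measurable_fun_coorP => i.
rewrite (_ : (fun _ => _) = fun x : 'rV[R]_n.+1 => x 0 (lift ord0 i)).
  exact: measurable_coor.
by apply/funext => x; rewrite /= mxE.
Qed.

Section lebesgue_cons.
Context n (mu : {sigma_finite_measure set 'rV[R]_n -> \bar R}).

Definition lebesgue_cons : set 'rV[R]_n.+1 -> \bar R :=
  pushforward (lebesgue_measure \x mu)%E (@consrV n).

Let cons0 : lebesgue_cons set0 = 0%E.
Proof. by rewrite /lebesgue_cons /pushforward preimage_set0 measure0. Qed.

Let cons_ge0 A : (0 <= lebesgue_cons A)%E.
Proof. by rewrite /lebesgue_cons /pushforward; apply: measure_ge0. Qed.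

Let cons_sigma_additive : semi_sigma_additive lebesgue_cons.
Proof.
move=> F mF tF mUF; rewrite /lebesgue_cons /pushforward preimage_bigcup.
apply: measure_semi_sigma_additive.
- by move=> k; rewrite -[X in measurable X]setTI; exact: measurable_consrV.
- apply/trivIsetP => /= i j _ _ ij; rewrite -preimage_setI.
  by move/trivIsetP : tF => /(_ _ _ _ _ ij) ->//; rewrite preimage_set0.
- by rewrite -preimage_bigcup -[X in measurable X]setTI; exact: measurable_consrV.
Qed.

HB.instance Definition _ := isMeasure.Build _ _ _ lebesgue_cons
  cons0 cons_ge0 cons_sigma_additive.

Let cons_sigma_finite : sigma_finite setT lebesgue_cons.
Proof.
have /sigma_finiteP[F [TF ndF Foo]] := sigma_finiteT (@lebesgue_measure R).
have /sigma_finiteP[G [TG ndG Goo]] := sigma_finiteT mu.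
exists (fun k => @unconsrV n @^-1` (F k `*` G k)).
  apply/esym/seteqP; split => // x _.
  have [a _ Fa] : (\bigcup_k F k) (unconsrV x).1 by rewrite -TF.
  have [b _ Gb] : (\bigcup_k G k) (unconsrV x).2 by rewrite -TG.
  exists (maxn a b) => //; split => /=.
  - by move: Fa; exact/subsetPset/ndF/leq_maxl.
  - by move: Gb; exact/subsetPset/ndG/leq_maxr.
move=> k; have [mF Fk] := Foo k; have [mG Gk] := Goo k; split.
  rewrite -[X in measurable X]setTI; apply: measurable_unconsrV => //.
  exact: measurableX.
rewrite /lebesgue_cons /pushforward -comp_preimage.
rewrite (_ : _ \o _ = id); last by apply/funext => x; exact: consrVK.
by rewrite preimage_id product_measure1E// lte_mul_pinfty// ge0_fin_numE.
Qed.

HB.instance Definition _ := Measure_isSigmaFinite.Build _ _ _ lebesgue_cons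
  cons_sigma_finite.

End lebesgue_cons.

Fixpoint lebesgue_rV n : {sigma_finite_measure set 'rV[R]_n -> \bar R} :=
  match n return {sigma_finite_measure set 'rV[R]_n -> \bar R} with
  | 0 => @dirac _ _ (0 : 'rV[R]_0) R
  | m.+1 => lebesgue_cons (lebesgue_rV m)
  end.

Lemma lebesgue_rV_box n (A : 'I_n -> set (measurableTypeR R)) :
  (forall i, measurable (A i)) ->
  lebesgue_rV n [set x : 'rV[R]_n | forall i, A i (x 0 i)] =
  (\prod_(i < n) lebesgue_measure (A i))%E.
Proof.
elim: n A => [A _|n IHn A mA].
  by rewrite big_ord0 /= diracE mem_set//= => -[].
rewrite big_ord_recl -IHn// -product_measure1E//; last first.
  have -> : [set x : 'rV[R]_n | forall i, A (lift ord0 i) (x 0 i)] =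
      \bigcap_(i in [set: 'I_n]) [set x : 'rV[R]_n | A (lift ord0 i) (x 0 i)].
    by apply/seteqP; split => x /= h i; [move=> _|]; exact: h.
  apply: fin_bigcap_measurable => // i _.
  by rewrite -[X in measurable X]setTI; apply: measurable_coor.
congr product_measure1; apply/seteqP; split => -[a x] /=.
  move=> h; split=> [|i]; first by have := h ord0; rewrite mxE unlift_none.
  by have := h (lift ord0 i); rewrite mxE liftK.
by move=> [h0 h] i; rewrite mxE; case: unliftP => [j|] -> /=.
Qed.

Definition lebesgue_time_space n :
    {measure set (measurableTypeR R * 'rV[R]_n)%type -> \bar R} :=
  (lebesgue_measure \x lebesgue_rV n)%E.

End lebesgue_rV.

(* Elements of [L2 mu D] are functions, not equivalence classes: equality in the
   Hilbert space is equality [mu]-a.e. on [D]. *)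

Section complex_L2.
Context d (T : measurableType d) (R : realType).
Context (mu : {measure set T -> \bar R}) (D : set T).
Implicit Types f g : T -> R[i].

Definition L2 : set (T -> R[i]) := [set f |
  [/\ measurable_fun D (fun x => Re (f x) : R),
      measurable_fun D (fun x => Im (f x) : R) &
      (\int[mu]_(x in D) (normc (f x) ^+ 2)%:E < +oo)%E]].

Definition cintegral f : R[i] :=
  Complex (\int[mu]_(x in D) Re (f x)) (\int[mu]_(x in D) Im (f x)).

Definition L2dot f g : R[i] := cintegral (fun x => f x * (g x)^*%C).

Definition L2norm f : R := Num.sqrt (Re (L2dot f f)).

Definition cvgL2 (v : nat -> T -> R[i]) f : Prop :=
  [/\ forall k, L2 (v k), L2 f &
      (fun k => L2norm (fun x => v k x - f x)) @ \oo --> (0 : R)].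

Definition Linfty (V : T -> R) : Prop :=
  measurable_fun D V /\
  exists M : R, \forall x \ae mu, D x -> `|V x| <= M.

End complex_L2.

Definition toC T (R : realType) (f : T -> R) : T -> R[i] := fun x => (f x)%:C%C.

Section space.
Context (R : realType) (n : nat).
Implicit Types (f g psi : 'rV[R]_n -> R) (Omega A : set 'rV[R]_n).

Definition partials (s : seq 'I_n) f : 'rV[R]_n -> R :=
  foldr (fun i h => 'D_(delta_mx 0 i) h) f s.

(* meant for open [A] *)
Definition Ck (k : nat) A f : Prop :=
  (forall s i x, (size s < k)%N -> A x ->
     derivable (partials s f) x (delta_mx 0 i)) /\
  (forall s x, (size s <= k)%N -> A x -> {for x, continuous (partials s f)}).

Definition bounded_domain Omega : Prop :=
  [/\ open Omega, connected Omega, Omega !=set0 & bounded_set Omega].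

Definition boundary Omega : set 'rV[R]_n := closure Omega `\` interior Omega.

Definition test_fun Omega psi : Prop :=
  (forall k, Ck k setT psi) /\
  exists K, [/\ compact K, K `<=` Omega & forall x, ~ K x -> psi x = 0].

Let leb : {measure set 'rV[R]_n -> \bar R} := lebesgue_rV R n.

Definition weak_partial Omega (i : 'I_n) f g : Prop :=
  forall psi, test_fun Omega psi ->
    \int[leb]_(x in Omega) (f x * 'D_(delta_mx 0 i) psi x) =
    - \int[leb]_(x in Omega) (g x * psi x).

Definition H1 Omega f : Prop :=
  L2 leb Omega (toC f) /\
  forall i, exists2 g, L2 leb Omega (toC g) & weak_partial Omega i f g.

Definition H2 Omega f : Prop :=
  H1 Omega f /\ forall i, exists2 g, H1 Omega g & weak_partial Omega i f g.

(* closure of the test functions for the H1 norm; [g] is the weak gradient *)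
Definition H10 Omega f : Prop :=
  exists (g : 'I_n -> 'rV[R]_n -> R) (psi : nat -> 'rV[R]_n -> R),
    [/\ forall i, weak_partial Omega i f (g i),
        forall k, test_fun Omega (psi k),
        cvgL2 leb Omega (fun k => toC (psi k)) (toC f) &
        forall i, cvgL2 leb Omega
          (fun k => toC ('D_(delta_mx 0 i) (psi k))) (toC (g i))].

End space.

(* After possibly relabelling and reflecting the coordinate axes, [Omega] is
   near each boundary point the region above the graph of a smooth function of
   the other coordinates. *)
Definition smooth_boundary (R : realType) n (Omega : set 'rV[R]_n) : Prop :=
  forall x0, boundary Omega x0 ->
  exists (r : R) (i : 'I_n) (s : bool) (gamma : 'rV[R]_n.-1 -> R),
    [/\ 0 < r, forall k, Ck k setT gamma &
        forall x, ball x0 r x ->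
          (Omega x <-> gamma (col' i x) < (-1) ^+ s * x 0 i)].

Section time.
Context (R : realType) (T : R).
Implicit Types theta g psi : R -> R.

Let leb : {measure set (measurableTypeR R) -> \bar R} := lebesgue_measure.
Let I : set (measurableTypeR R) := `]0, T[.

Definition test_fun_time psi : Prop :=
  (forall k t, derivable (derive1n k psi) t 1) /\
  exists K : set R, [/\ compact K, K `<=` I & forall t, ~ K t -> psi t = 0].

Definition weak_derivative theta g : Prop :=
  forall psi, test_fun_time psi ->
    \int[leb]_(t in I) (theta t * derive1 psi t) =
    - \int[leb]_(t in I) (g t * psi t).

(* the value at [T] is that of the continuous representative *)
Definition H1T theta : Prop :=
  [/\ L2 leb I (toC theta),
      exists2 g, L2 leb I (toC g) & weak_derivative theta g &
      exists c : R -> R, [/\ {within `[0, T], continuous c},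
        theta = c %[ae leb in I] & c T = 0]].

Definition spline (Nt : nat) theta : Prop :=
  forall j : 'I_Nt, exists p : {poly R}, forall t : R,
    j%:R * (T / Nt%:R) < t < j.+1%:R * (T / Nt%:R) -> theta t = p.[t].

End time.

Section schroedinger.
Context (R : realType) (n : nat) (T : R) (Omega : set 'rV[R]_n).

Let XT := (measurableTypeR R * 'rV[R]_n)%type.
Let mu : {measure set XT -> \bar R} := lebesgue_time_space R n.

Definition cylinder : set XT := `]0, T[ `*` Omega.

Definition dt (f : R * 'rV[R]_n -> R) (p : R * 'rV[R]_n) : R :=
  derive1 (fun t => f (t, p.2)) p.1.

Definition dx (s : seq 'I_n) (f : R * 'rV[R]_n -> R) (p : R * 'rV[R]_n) : R :=
  partials s (fun x => f (p.1, x)) p.2.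

Definition laplacian (f : R * 'rV[R]_n -> R) (p : R * 'rV[R]_n) : R :=
  \sum_(i < n) dx [:: i; i] f p.

Definition componentwise (L : (R * 'rV[R]_n -> R) -> R * 'rV[R]_n -> R)
    (v : R * 'rV[R]_n -> R[i]) (p : R * 'rV[R]_n) : R[i] :=
  Complex (L (fun q => Re (v q)) p) (L (fun q => Im (v q)) p).

Definition S0star (V : XT -> R) (v : XT -> R[i]) : XT -> R[i] := fun p =>
  'i%C * componentwise dt v p + 2^-1 * componentwise laplacian v p
  - (V p)%:C%C * v p.

Definition C12_zero (f : R * 'rV[R]_n -> R) : Prop :=
  [/\ {within closure (cylinder : set (R * 'rV[R]_n)), continuous f},
      forall p, cylinder p ->
        derivable (fun t => f (t, p.2)) p.1 1 /\ {for p, continuous (dt f)},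
      (forall t, 0 < t < T -> Ck 2 Omega (fun x => f (t, x))) /\
      (forall s p, (size s <= 2)%N -> cylinder p ->
        {for p, continuous (dx s f)}),
      forall x, closure Omega x -> f (T, x) = 0 &
      forall t x, 0 < t < T -> boundary Omega x -> f (t, x) = 0].

Definition DS0star (V : XT -> R) : set (XT -> R[i]) := [set v |
  [/\ C12_zero (fun p => Re (v p)), C12_zero (fun p => Im (v p)) &
      L2 mu cylinder (S0star V v)]].

(* The completion of [DS0star V] for the norm [Unorm \o S0star V], realised
   inside L2: [v] is the L2 limit of a sequence that is Cauchy for this norm, and
   [w] is the limit of the images of that sequence. *)
Definition closureS (V : XT -> R) (v w : XT -> R[i]) : Prop :=
  exists vk : nat -> XT -> R[i],
    [/\ forall k, DS0star V (vk k), cvgL2 mu cylinder vk v &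
        cvgL2 mu cylinder (fun k => S0star V (vk k)) w].

Definition Vspace (V : XT -> R) : set (XT -> R[i]) :=
  [set v | exists w, closureS V v w].

Definition Sstar (V : XT -> R) (v : XT -> R[i]) : XT -> R[i] :=
  xget (fun=> 0) (closureS V v).

Definition Unorm (u : XT -> R[i]) : R := L2norm mu cylinder u.

Definition Vnorm (V : XT -> R) (v : XT -> R[i]) : R := Unorm (Sstar V v).

Definition bform (V : XT -> R) (u v : XT -> R[i]) : R[i] :=
  L2dot mu cylinder u (Sstar V v).

Definition eqU (u v : XT -> R[i]) : Prop := u = v %[ae mu in cylinder].

Definition Vdual (V : XT -> R) : set ((XT -> R[i]) -> R[i]) := [set g |
  (forall (a : R[i]) v w, Vspace V v -> Vspace V w ->
     g (fun p => a * v p + w p) = a^*%C * g v + g w) /\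
  exists C : R, forall v, Vspace V v -> Normc.normc (g v) <= C * Vnorm V v].

Section discrete.
Context (V : XT -> R) (Nt Nh : nat).
Context (rho : 'I_Nt -> R -> R) (phi : 'I_Nh -> 'rV[R]_n -> R).

Definition Vdelta : set (XT -> R[i]) := [set v |
  exists c : 'M[R[i]]_(Nt, Nh), v = fun p =>
    \sum_(k < Nt) \sum_(i < Nh) c k i * (rho k p.1 * phi i p.2)%:C%C].

Definition Udelta : set (XT -> R[i]) := [set u |
  L2 mu cylinder u /\ exists2 v, Vdelta v & eqU u (Sstar V v)].

Definition beta_delta : \bar R :=
  ereal_inf [set ereal_sup
    [set (normc (bform V u v) / (Unorm u * Vnorm V v))%:E |
       v in Vdelta `&` [set v | ~ eqU v (fun=> 0)]] |
    u in Udelta `&` [set u | ~ eqU u (fun=> 0)]].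

Definition petrov_galerkin (g : (XT -> R[i]) -> R[i]) (u : XT -> R[i]) : Prop :=
  Udelta u /\ forall v, Vdelta v -> bform V u v = g v.

(* [rho] is a basis of R_dt, so that dim R_dt = Nt; each element is a polynomial
   on every cell of the uniform mesh of width T / Nt *)
Definition temporal_basis : Prop :=
  [/\ forall k, H1T T (rho k), forall k, spline T Nt (rho k) &
      forall a : 'I_Nt -> R,
        (fun t => \sum_(k < Nt) a k * rho k t) = (fun=> 0)
          %[ae (@lebesgue_measure R) in `]0, T[%classic] ->
        forall k, a k = 0].

Definition spatial_basis : Prop :=
  [/\ forall i, H10 Omega (phi i), forall i, H2 Omega (phi i) &
      forall a : 'I_Nh -> R,
        (fun x => \sum_(i < Nh) a i * phi i x) = (fun=> 0)
          %[ae (lebesgue_rV R n) in Omega] ->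
        forall i, a i = 0].

End discrete.
End schroedinger.

(* Main.v *)
Require Import Defs.
From mathcomp Require Import all_boot all_order all_algebra.
From mathcomp Require Import all_classical all_reals all_analysis.
From mathcomp Require Import complex.
From mathcomp Require Import measurable_realfun ring lra.

Set Implicit Arguments.
Unset Strict Implicit.
Unset Printing Implicit Defensive.

Import Order.TTheory GRing.Theory Num.Theory.
Import numFieldNormedType.Exports.
Local Open Scope classical_set_scope.
Local Open Scope ring_scope.

(** The space [U_delta] is by definition the image of [V_delta] under [S^*], so
    for [u = S^* v] the choice [v] of test function makes the quotient equal to
    [|u|^2 / (|u| |S^* v|) = 1], while the Cauchy-Schwarz inequality bounds all
    quotients by [1] ([sup_ratio]).  Every inner supremum is thus [1], and so is
    the infimum, as soon as [U_delta] contains a nonzero element.  Solutions of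
    the Petrov-Galerkin problem are unique because the difference of two of them
    is some [S^* z] with [z] in [V_delta], hence orthogonal to itself.  They exist
    because the Gram system of a spanning family of [U_delta] is consistent: a
    combination [v] with [S^* v = 0] satisfies [|g v| <= C |v|_V = 0]
    ([gram_solve], [petrov_galerkin_exists]).

    Two facts about the operator carry this argument.

    First, [S^* v], which is selected among the limits of [S0^* v_k] over all
    sequences of smooth functions [v_k] converging to [v], has to depend linearly
    on [v] up to null sets.  Smooth functions satisfy
    [(S0^* v, Psi) = (v, S Psi)] for real, compactly supported [Psi] that are
    [C^1] in time and [C^2] in space ([S0star_symmetric]): the two integrands
    differ by derivatives of compactly supported functions, whose integrals vanish
    line by line ([integral_dt0], [integral_dx0]).  Both sides are continuous in
    [L2], so every limit [w] satisfies [(w, Psi) = (v, S Psi)] as well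
    ([closureS_weak]).  Products of one-dimensional plateaus converge boundedly
    to indicators of boxes, and the boxes generate the measurable sets; hence
    these identities determine [w] almost everywhere
    ([plateau_orthogonal_ae0], [weak_Sstar_unique]), and linearity follows.

    Second, [S^*] does not kill the basis element [rho phi].  As [rho], [phi],
    [V] and the test functions are real, the imaginary part of
    [(rho phi, S Psi) = 0] is the orthogonality of [rho phi] to all time
    derivatives [Psi_t].  For product tests Fubini factors this into
    [(rho, psi') (phi, chi) = 0].  If [phi] is not zero, then [rho] is orthogonal
    to the derivatives of all test functions of time, hence constant by the lemma
    of du Bois-Reymond, and the constant is [rho T = 0]
    ([hat_orthogonal_ae0], [tensor_orthogonal_ae0]).  Either way one of the two
    bases would contain a null function. *)

Local Notation Re := complex.Re.
Local Notation Im := complex.Im.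
Local Notation normc := Normc.normc.

(** * Complex square integrable functions *)

Lemma normc_sq (R : rcfType) (z : R[i]) : normc z ^+ 2 = Re z ^+ 2 + Im z ^+ 2.
Proof. by case: z => a b /=; rewrite sqr_sqrtr// addr_ge0 ?sqr_ge0. Qed.

Lemma normc_ge0 (R : rcfType) (z : R[i]) : 0 <= normc z.
Proof. by case: z => a b; exact: sqrtr_ge0. Qed.

Lemma mul_conjC (R : rcfType) (z : R[i]) : z * (z^*)%C = ((normc z ^+ 2)%:C)%C.
Proof. by case: z => a b; rewrite normc_sq /=; simpc; congr Complex; ring. Qed.

Section complex_parts.
Context (R : rcfType).
Implicit Types z w : R[i].

Lemma ReD z w : Re (z + w) = Re z + Re w. Proof. by case: z w => ? ? []. Qed.
Lemma ImD z w : Im (z + w) = Im z + Im w. Proof. by case: z w => ? ? []. Qed.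
Lemma ReM z w : Re (z * w) = Re z * Re w - Im z * Im w.
Proof. by case: z w => ? ? []. Qed.
Lemma ImM z w : Im (z * w) = Re z * Im w + Im z * Re w.
Proof. by case: z w => ? ? []. Qed.
Lemma ReJ z : Re (z^*)%C = Re z. Proof. by case: z. Qed.
Lemma ImJ z : Im (z^*)%C = - Im z. Proof. by case: z. Qed.
Lemma ReN z : Re (- z) = - Re z. Proof. by case: z. Qed.
Lemma ImN z : Im (- z) = - Im z. Proof. by case: z. Qed.
Definition partsE := (ReD, ImD, ReN, ImN, ReM, ImM, ReJ, ImJ).

End complex_parts.

Section square_integrable.
Context d (X : measurableType d) (R : realType).
Context (mu : {measure set X -> \bar R}) (D : set X) (mD : measurable D).
Implicit Types (a b : X -> R) (f g h : X -> R[i]).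

Definition real_L2 a := measurable_fun D a /\
  mu.-integrable D (EFin \o (fun x => a x ^+ 2)).

Lemma real_L2M a b : real_L2 a -> real_L2 b ->
  mu.-integrable D (EFin \o (fun x => a x * b x)).
Proof.
move=> [ma ia] [mb ib].
have iab : mu.-integrable D (EFin \o (fun x => a x ^+ 2 + b x ^+ 2)).
  by have := integrableD mD ia ib; apply: eq_integrable => // x _.
apply: (le_integrable mD _ _ iab).
  by apply/measurable_EFinP; exact: measurable_funM.
move=> x _ /=; rewrite lee_fin normrM [leRHS]ger0_norm ?addr_ge0 ?sqr_ge0//.
by rewrite -[a x ^+ 2]real_normK ?num_real// -[b x ^+ 2]real_normK ?num_real//; nra.
Qed.

Lemma real_L2Z (k : R) a : real_L2 a -> real_L2 (fun x => k * a x).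
Proof.
move=> [ma ia]; split; first exact: measurable_funM.
have := integrableZl mD (k ^+ 2) ia; apply: eq_integrable => // x _ /=.
by rewrite -EFinM exprMn.
Qed.

Lemma real_L2D a b : real_L2 a -> real_L2 b -> real_L2 (fun x => a x + b x).
Proof.
move=> La Lb; have [[ma ia] [mb ib]] := (La, Lb).
split; first exact: measurable_funD.
have := integrableD mD (integrableD mD ia ib)
  (integrableZl mD 2 (real_L2M La Lb)).
by apply: eq_integrable => // x _ /=; congr (_%:E); ring.
Qed.

(** Complex square integrability reduces to the real one of the two parts; the
    algebra of [L2] below is the algebra of [real_L2] in these coordinates. *)
Lemma L2P f : L2 mu D f <-> real_L2 (fun x => Re (f x)) /\ real_L2 (fun x => Im (f x)).
Proof.
split=> [[mr mi If]|[[mr ir] [mi ii]]].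
  have In : mu.-integrable D (EFin \o (fun x => normc (f x) ^+ 2)).
    apply/integrableP; split.
      apply/measurable_EFinP; under eq_fun do rewrite normc_sq.
      by apply: measurable_funD; exact: measurable_funX.
    under eq_integral do rewrite /= ger0_norm ?sqr_ge0//.
    exact: If.
  split; split => //; apply: (le_integrable mD _ _ In).
  - by apply/measurable_EFinP; exact: measurable_funX.
  - move=> x _; rewrite /= lee_fin !ger0_norm ?sqr_ge0// normc_sq.
    by rewrite lerDl sqr_ge0.
  - by apply/measurable_EFinP; exact: measurable_funX.
  - move=> x _; rewrite /= lee_fin !ger0_norm ?sqr_ge0// normc_sq.
    by rewrite lerDr sqr_ge0.
split=> //; have /integrableP[_] := integrableD mD ir ii.
congr (_ < _)%E; apply: eq_integral => x _ /=.
by rewrite normc_sq ger0_norm ?addr_ge0 ?sqr_ge0.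
Qed.

Lemma L2_lin (c : R[i]) f g : L2 mu D f -> L2 mu D g ->
  L2 mu D (fun x => c * f x + g x).
Proof.
move=> /L2P[fr fi] /L2P[gr gi]; apply/L2P; split.
  have := real_L2D (real_L2D (real_L2Z (Re c) fr) (real_L2Z (- Im c) fi)) gr.
  congr real_L2; apply/funext => x; rewrite !partsE.
  by ring.
have := real_L2D (real_L2D (real_L2Z (Re c) fi) (real_L2Z (Im c) fr)) gi.
congr real_L2; apply/funext => x; rewrite !partsE.
by ring.
Qed.

Definition cintegrable f :=
  mu.-integrable D (EFin \o (fun x => Re (f x))) /\
  mu.-integrable D (EFin \o (fun x => Im (f x))).

Lemma L2_cintegrable f g : L2 mu D f -> L2 mu D g ->
  cintegrable (fun x => f x * (g x)^*%C).
Proof.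
move=> /L2P[fr fi] /L2P[gr gi]; split.
  have := integrableD mD (real_L2M fr gr) (real_L2M fi gi).
  apply: eq_integrable => // x _; rewrite /= !partsE.
  by congr (_%:E); ring.
have := integrableB mD (real_L2M fi gr) (real_L2M fr gi).
apply: eq_integrable => // x _; rewrite /= !partsE.
by congr (_%:E); ring.
Qed.

Lemma cintegral_lin (c : R[i]) f g : cintegrable f -> cintegrable g ->
  cintegral mu D (fun x => c * f x + g x) =
  c * cintegral mu D f + cintegral mu D g.
Proof.
case: c => c1 c2 [fr fi] [gr gi]; rewrite /cintegral.
have E1 := RintegralD mD (integrableB mD (integrableZl mD c1 fr)
  (integrableZl mD c2 fi)) gr.
have E2 := RintegralD mD (integrableD mD (integrableZl mD c1 fi)
  (integrableZl mD c2 fr)) gi.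
have F1 := RintegralB mD (integrableZl mD c1 fr) (integrableZl mD c2 fi).
have F2 := RintegralD mD (integrableZl mD c1 fi) (integrableZl mD c2 fr).
rewrite !RintegralZl// in F1, F2.
rewrite F1 in E1; rewrite F2 in E2.
congr Complex.
  rewrite -E1; by apply: eq_Rintegral => x _; rewrite !partsE.
rewrite -E2; by apply: eq_Rintegral => x _; rewrite !partsE.
Qed.

Lemma L2dot_lin (c : R[i]) f f' g : L2 mu D f -> L2 mu D f' -> L2 mu D g ->
  L2dot mu D (fun x => c * f x + f' x) g = c * L2dot mu D f g + L2dot mu D f' g.
Proof.
move=> Lf Lf' Lg; rewrite /L2dot -cintegral_lin; [|exact: L2_cintegrable..].
by congr cintegral; apply/funext => x; rewrite mulrDl mulrA.
Qed.

Lemma L2dot_conj f g : L2 mu D f -> L2 mu D g ->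
  L2dot mu D g f = (L2dot mu D f g)^*%C.
Proof.
move=> Lf Lg; have [Ir Ii] := L2_cintegrable Lf Lg.
rewrite /L2dot /cintegral /=; congr Complex.
  by apply: eq_Rintegral => x _; rewrite !partsE; ring.
rewrite -mulN1r -RintegralZl//.
by apply: eq_Rintegral => x _; rewrite !partsE; ring.
Qed.

Lemma L2dot_linr (c : R[i]) f g g' : L2 mu D f -> L2 mu D g -> L2 mu D g' ->
  L2dot mu D f (fun x => c * g x + g' x) =
  c^*%C * L2dot mu D f g + L2dot mu D f g'.
Proof.
move=> Lf Lg Lg'; have Lgg := L2_lin c Lg Lg'.
rewrite (L2dot_conj Lgg Lf) L2dot_lin// (L2dot_conj Lf Lg) (L2dot_conj Lf Lg').
by apply/eqP; rewrite eq_complex !partsE; apply/andP; split; apply/eqP; ring.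
Qed.

Lemma ae_eq_L2dot f f' g g' : L2 mu D f -> L2 mu D f' -> L2 mu D g -> L2 mu D g' ->
  f = f' %[ae mu in D] -> g = g' %[ae mu in D] ->
  L2dot mu D f g = L2dot mu D f' g'.
Proof.
move=> Lf Lf' Lg Lg' ff gg.
have [[+ _] [+ _]] := (L2_cintegrable Lf Lg, L2_cintegrable Lf' Lg').
have [[_ +] [_ +]] := (L2_cintegrable Lf Lg, L2_cintegrable Lf' Lg').
move=> /integrableP[i1 _] /integrableP[i2 _] /integrableP[r1 _] /integrableP[r2 _].
have E : \forall x \ae mu, D x -> f x * (g x)^*%C = f' x * (g' x)^*%C.
  near=> x => Dx; congr (_ * _^*%C); move: Dx.
    by near: x; exact: ff.
  by near: x; exact: gg.
rewrite /L2dot /cintegral /Rintegral; congr (Complex (fine _) (fine _)).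
  apply: ae_eq_integral => //; near=> x => Dx /=; congr (Re _)%:E; move: Dx.
  by near: x; exact: E.
apply: ae_eq_integral => //; near=> x => Dx /=; congr (Im _)%:E; move: Dx.
by near: x; exact: E.
Unshelve. all: by end_near. Qed.

Lemma L2_0 : L2 mu D (fun=> 0 : R[i]).
Proof.
split; [exact: measurable_cst..|].
by rewrite integral0_eq// => x _; rewrite Normc.normc0 expr0n.
Qed.

Lemma L2dot_ae0 f g : L2 mu D f -> L2 mu D g -> f = (fun=> 0) %[ae mu in D] ->
  L2dot mu D f g = 0.
Proof.
move=> Lf Lg f0; rewrite (ae_eq_L2dot Lf L2_0 Lg Lg f0); last exact: ae_eq_refl.
by rewrite /L2dot /cintegral /Rintegral !integral0_eq// => x _; rewrite mul0r.
Qed.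

Lemma L2Z (c : R[i]) f : L2 mu D f -> L2 mu D (fun x => c * f x).
Proof.
have -> : (fun x => c * f x) = (fun x => c * f x + 0).
  by apply/funext => x; rewrite addr0.
by move=> Lf; exact: L2_lin L2_0.
Qed.

Lemma L2B f g : L2 mu D f -> L2 mu D g -> L2 mu D (fun x => f x - g x).
Proof.
have -> : (fun x => f x - g x) = (fun x => - 1 * g x + f x).
  by apply/funext => x; rewrite mulN1r addrC.
by move=> Lf Lg; exact: L2_lin.
Qed.

Lemma L2dotZl (c : R[i]) f g : L2 mu D f -> L2 mu D g ->
  L2dot mu D (fun x => c * f x) g = c * L2dot mu D f g.
Proof.
have -> : (fun x => c * f x) = (fun x => c * f x + 0).
  by apply/funext => x; rewrite addr0.
move=> Lf Lg; rewrite (L2dot_lin c Lf L2_0 Lg) (L2dot_ae0 L2_0 Lg) ?addr0//.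
exact: ae_eq_refl.
Qed.

Lemma L2dotBl f f' g : L2 mu D f -> L2 mu D f' -> L2 mu D g ->
  L2dot mu D (fun x => f x - f' x) g = L2dot mu D f g - L2dot mu D f' g.
Proof.
have -> : (fun x => f x - f' x) = (fun x => - 1 * f' x + f x).
  by apply/funext => x; rewrite mulN1r addrC.
by move=> Lf Lf' Lg; rewrite L2dot_lin// mulN1r addrC.
Qed.

Lemma L2dot_self f : L2dot mu D f f = ((L2norm mu D f ^+ 2)%:C)%C.
Proof.
have E : (fun x => f x * (f x)^*%C) = (fun x => ((normc (f x) ^+ 2)%:C)%C).
  by apply/funext => x; rewrite mul_conjC.
have D0 : 0 <= Re (L2dot mu D f f).
  by rewrite /L2dot E /=; apply: Rintegral_ge0 => x _; exact: sqr_ge0.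
rewrite /L2norm sqr_sqrtr//; rewrite /L2dot E; congr Complex.
by rewrite /= /Rintegral integral0.
Qed.

Lemma L2norm_ge0 f : 0 <= L2norm mu D f. Proof. exact: sqrtr_ge0. Qed.

Lemma L2norm0_ae f : L2 mu D f -> L2norm mu D f = 0 -> f = (fun=> 0) %[ae mu in D].
Proof.
move=> Lf nf; have := L2dot_self f; rewrite nf expr0n /= /L2dot.
have -> : (fun x => f x * (f x)^*%C) = (fun x => ((normc (f x) ^+ 2)%:C)%C).
  by apply/funext => x; rewrite mul_conjC.
case=> + _; rewrite /Rintegral /= => I0.
have [mr mi Ifoo] := Lf.
have I00 : (\int[mu]_(x in D) `|(normc (f x) ^+ 2)%:E| = 0)%E.
  under eq_integral do rewrite gee0_abs ?lee_fin ?sqr_ge0//.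
  move: I0 Ifoo.
  have : (0 <= \int[mu]_(x in D) (normc (f x) ^+ 2)%:E)%E.
    by apply: integral_ge0 => x _; rewrite lee_fin sqr_ge0.
  by case: (\int[mu]_(x in D) _)%E => //= r _ ->.
have mn : measurable_fun D (fun x => (normc (f x) ^+ 2)%:E).
  apply/measurable_EFinP; under eq_fun do rewrite normc_sq.
  by apply: measurable_funD; exact: measurable_funX.
have := (ae_eq_integral_abs mu mD mn).1 I00.
apply: filterS => x + Dx => /(_ Dx)/= [] /eqP; rewrite sqrf_eq0 => /eqP.
by move/Normc.eq0_normc.
Qed.

(** Expanding the nonnegative square norm of [|g|^2 f - (f, g) g] gives the
    inequality once it is divided by [|g|^2]. *)
Lemma cauchy_schwarz f g : L2 mu D f -> L2 mu D g ->
  normc (L2dot mu D f g) <= L2norm mu D f * L2norm mu D g.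
Proof.
move=> Lf Lg; set a := L2norm mu D g; set b := L2norm mu D f.
have [a0|a0] := eqVneq a 0.
  rewrite (ae_eq_L2dot Lf Lf Lg (L2_lin (-1) Lg Lg)).
  - rewrite L2dot_linr// mulrC rmorphN rmorph1 mulrN1 addNr.
    by rewrite Normc.normc0 mulr_ge0 ?L2norm_ge0.
  - exact: ae_eq_refl.
  - apply: filterS (L2norm0_ae Lg a0) => x h Dx.
    by rewrite h//= mulN1r addNr.
have agt0 : 0 < a by rewrite lt0r a0 L2norm_ge0.
set z := L2dot mu D f g.
have Lf2 := L2Z (a ^+ 2)%:C%C Lf; have Lk := L2_lin (- z) Lg Lf2.
have := L2dot_self (fun x => (- z) * g x + (a ^+ 2)%:C%C * f x).
rewrite L2dot_lin// L2dotZl// L2dot_linr// L2dot_linr//.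
rewrite (L2dot_conj Lf2 Lg) (L2dot_conj Lf2 Lf) !L2dotZl// !L2dot_self -/a -/b -/z.
set N := L2norm mu D _.
have -> : - z * ((- z)^*%C * (a ^+ 2)%:C%C + ((a ^+ 2)%:C%C * z)^*%C) = 0.
  by apply/eqP; rewrite eq_complex !partsE /=; apply/andP; split; apply/eqP; ring.
case: z {Lk} @N => z1 z2 N /= [] E _.
have E' : a ^+ 2 * (a ^+ 2 * b ^+ 2 - (z1 ^+ 2 + z2 ^+ 2)) = N ^+ 2.
  by rewrite -E; ring.
have : 0 <= a ^+ 2 * b ^+ 2 - (z1 ^+ 2 + z2 ^+ 2).
  by rewrite -(pmulr_rge0 _ (exprn_gt0 2 agt0)) E' sqr_ge0.
rewrite subr_ge0 -exprMn => h.
rewrite -(@ler_pXn2r _ 2) ?nnegrE ?sqrtr_ge0 ?mulr_ge0 ?L2norm_ge0//.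
by rewrite sqr_sqrtr ?addr_ge0 ?sqr_ge0// [b * a]mulrC.
Qed.

(** By Cauchy-Schwarz, pairing with a fixed function is continuous; this is what
    carries the integration by parts from smooth functions to their limits. *)
Lemma cvgL2_dot (v : nat -> X -> R[i]) f g : cvgL2 mu D v f -> L2 mu D g ->
  (fun k => normc (L2dot mu D (v k) g - L2dot mu D f g)) @ \oo --> (0 : R).
Proof.
move=> [Lv Lf cv] Lg; have Lvf k := L2B (Lv k) Lf.
under eq_fun do rewrite -L2dotBl//.
apply: (@squeeze_cvgr _ _ _ _ (fun=> 0)
  (fun k => L2norm mu D (fun x => v k x - f x) * L2norm mu D g)).
- by near=> k; rewrite normc_ge0 cauchy_schwarz.
- exact: cvg_cst.
- rewrite -(mul0r (L2norm mu D g)); apply: cvgM => //; exact: cvg_cst.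
Unshelve. all: by end_near. Qed.

End square_integrable.

Section finite_L2.
Context d (X : measurableType d) (R : realType).
Context (mu : {measure set X -> \bar R}) (D : set X) (mD : measurable D).
Hypothesis Doo : (mu D < +oo)%E.

Lemma ae_bounded_real_L2 (a : X -> R) (C : R) : measurable_fun D a ->
  (\forall x \ae mu, D x -> `|a x| <= C) -> real_L2 mu D a.
Proof.
move=> ma aC; split=> //.
have ma2 : measurable_fun D (EFin \o (fun x => a x ^+ 2)).
  by apply/measurable_EFinP; exact: measurable_funX.
apply/integrableP; split=> //.
have C2 : (0 <= (C ^+ 2)%:E)%E by rewrite lee_fin sqr_ge0.
apply: (@le_lt_trans _ _ ((C ^+ 2)%:E * mu D)%E); last exact: lte_mul_pinfty.
apply: integral_le_bound => //.
apply: filterS aC => x + Dx => /(_ Dx) aC /=.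
rewrite lee_fin normrX ler_pXn2r// nnegrE//.
exact: le_trans aC.
Qed.

(** Reduces an equality of integrals to a pointwise identity that involves
    two further integrands of integral zero. *)
Lemma Rintegral_add0 (c1 c2 : R) (e1 e2 h : X -> R) :
  mu.-integrable D (EFin \o e1) /\ \int[mu]_(x in D) e1 x = 0 ->
  mu.-integrable D (EFin \o e2) /\ \int[mu]_(x in D) e2 x = 0 ->
  mu.-integrable D (EFin \o h) ->
  \int[mu]_(x in D) (c1 * e1 x + c2 * e2 x + h x) = \int[mu]_(x in D) h x.
Proof.
move=> [i1 z1] [i2 z2] ih.
have j1 := integrableZl mD c1 i1; have j2 := integrableZl mD c2 i2.
rewrite RintegralD//; last by have := integrableD mD j1 j2; apply: eq_integrable.
by rewrite RintegralD// !RintegralZl// z1 z2 !mulr0 !add0r.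
Qed.

Lemma real_L2_integrable (a : X -> R) : real_L2 mu D a -> mu.-integrable D (EFin \o a).
Proof.
move=> La; have L1 : real_L2 mu D (fun=> 1).
  apply: (ae_bounded_real_L2 (C := 1)); first exact: measurable_cst.
  by apply: aeW => x _; rewrite normr1.
by have := real_L2M mD La L1; apply: eq_integrable => // x _ /=; rewrite mulr1.
Qed.

End finite_L2.

(** * Gram systems *)

Section gram.
Context d (X : measurableType d) (R : realType).
Context (mu : {measure set X -> \bar R}) (D : set X) (mD : measurable D).
Context (m : nat) (w : 'I_m -> X -> R[i]) (Lw : forall j, L2 mu D (w j)).

(** The sum runs over an arbitrary sequence so that linearity can be proved by
    induction on it. *)
Definition comb (s : seq 'I_m) (f : 'I_m -> X -> R[i]) (c : 'I_m -> R[i]) : X -> R[i] :=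
  fun p => \sum_(j <- s) c j * f j p.

Lemma comb_nil f c : comb [::] f c = fun=> 0.
Proof. by apply/funext => p; rewrite /comb big_nil. Qed.

Lemma comb_cons j s f c : comb (j :: s) f c = fun p => c j * f j p + comb s f c p.
Proof. by apply/funext => p; rewrite /comb big_cons. Qed.

Lemma L2_comb s c : L2 mu D (comb s w c).
Proof.
elim: s => [|j s IH]; first by rewrite comb_nil; exact: L2_0.
by rewrite comb_cons; exact: L2_lin.
Qed.

Lemma L2dot_combl s c g : L2 mu D g ->
  L2dot mu D (comb s w c) g = \sum_(j <- s) c j * L2dot mu D (w j) g.
Proof.
move=> Lg; elim: s => [|j s IH].
  by rewrite comb_nil big_nil L2dot_ae0//; [exact: L2_0|exact: ae_eq_refl].
by rewrite comb_cons big_cons L2dot_lin// ?IH//; exact: L2_comb.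
Qed.

Lemma L2dot_combr s c f : L2 mu D f ->
  L2dot mu D f (comb s w c) = \sum_(j <- s) (c j)^*%C * L2dot mu D f (w j).
Proof.
move=> Lf; elim: s => [|j s IH].
  rewrite comb_nil big_nil (L2dot_conj mD (L2_0 mu D) Lf) L2dot_ae0//; last 2 first.
  - exact: L2_0.
  - exact: ae_eq_refl.
  exact: rmorph0.
by rewrite comb_cons big_cons L2dot_linr// ?IH//; exact: L2_comb.
Qed.

Let G : 'M[R[i]]_m := \matrix_(j, k) L2dot mu D (w j) (w k).

(** The Gram matrix may be singular: a vector in its kernel is a combination of
    norm zero, and the consistency condition is that [gamma] kills it too. *)
Lemma gram_solve (gamma : 'I_m -> R[i]) :
  (forall c, L2norm mu D (comb (index_enum _) w c) = 0 ->
     \sum_j (c j)^*%C * gamma j = 0) ->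
  exists c, forall k, L2dot mu D (comb (index_enum _) w c) (w k) = gamma k.
Proof.
move=> hg; pose g : 'rV[R[i]]_m := \row_k gamma k.
have /submxP[c gc] : (g <= G)%MS.
  rewrite submxE; apply/eqP/rowP => l; rewrite [RHS]mxE mxE.
  pose c j := (cokermx G j l)^*%C.
  under eq_bigr => j _ do rewrite mxE mulrC -[cokermx G j l]conjcK.
  apply: (hg c); apply/eqP; rewrite -sqrf_eq0; apply/eqP.
  have : L2dot mu D (comb (index_enum _) w c) (comb (index_enum _) w c) = 0.
    rewrite L2dot_combl; last exact: L2_comb.
    rewrite big1// => j _; rewrite L2dot_combr//.
    have := congr1 (fun M : 'M[R[i]]_m => M j l) (mulmx_coker G); rewrite !mxE => E.
    rewrite (_ : \sum_(k <- _) _ = 0) ?mulr0// -[RHS]E; apply: eq_bigr => k _.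
    by rewrite /c conjcK [G j k]mxE mulrC.
  by rewrite L2dot_self => -[].
exists (fun j => c 0 j) => k; rewrite L2dot_combl//.
have := congr1 (fun M : 'rV[R[i]]_m => M 0 k) gc; rewrite !mxE => ->.
by apply: eq_bigr => j _; rewrite mxE.
Qed.

End gram.

(** * Boxes and measurability *)

Section boxes.
Context (R : realType) (n : nat).
Let XT := (measurableTypeR R * 'rV[R]_n)%type.
Implicit Types (a b : R) (u v : 'rV[R]_n) (p : R * 'rV[R]_n).

Definition box a b u v : set XT :=
  [set p : XT | a < p.1 < b /\ forall i, u 0 i < p.2 0 i < v 0 i].
Definition cbox a b u v : set (R * 'rV[R]_n) :=
  [set p : R * 'rV[R]_n | a <= p.1 <= b /\ forall i, u 0 i <= p.2 0 i <= v 0 i].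

Lemma sub_box_cbox a b u v : box a b u v `<=` cbox a b u v.
Proof.
move=> p [/andP[ap pb] h]; split; first by rewrite !ltW.
by move=> i; have /andP[? ?] := h i; rewrite !ltW.
Qed.

Lemma boxE a b u v : box a b u v =
  (fst @^-1` (`]a, b[%classic : set (measurableTypeR R))) `&`
  \bigcap_(i in [set: 'I_n])
    ((fun p : XT => p.2 0 i : measurableTypeR R) @^-1` `]u 0 i, v 0 i[%classic).
Proof.
apply/seteqP; split => p /=.
  by move=> [h1 h2]; split; [rewrite /= in_itv|move=> i _; rewrite /= in_itv; exact: h2].
move=> [h1 h2]; split; first by move: h1; rewrite /= in_itv.
by move=> i; have := h2 i I; rewrite /= in_itv.
Qed.

Lemma measurable_coor2 (i : 'I_n) :
  measurable_fun setT (fun p : XT => p.2 0 i : measurableTypeR R).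
Proof.
apply: (@measurableT_comp _ _ _ _ _ _ (fun x : 'rV[R]_n => x 0 i : measurableTypeR R)).
  exact: measurable_coor.
exact: measurable_snd.
Qed.

Lemma measurable_box a b u v : measurable (box a b u v).
Proof.
rewrite boxE; apply: measurableI.
  by rewrite -[X in measurable X]setTI; apply: measurable_fst => //; exact: measurable_itv.
apply: fin_bigcap_measurable => // i _.
by rewrite -[X in measurable X]setTI; apply: measurable_coor2 => //; exact: measurable_itv.
Qed.

Lemma boxI a b u v a' b' u' v' : box a b u v `&` box a' b' u' v' =
  box (Num.max a a') (Num.min b b') (\row_i Num.max (u 0 i) (u' 0 i))
    (\row_i Num.min (v 0 i) (v' 0 i)).
Proof.
apply/seteqP; split => p /=.
  move=> [[/andP[h1 h2] h3] [/andP[h4 h5] h6]]; split.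
    by rewrite gt_max lt_min h1 h2 h4 h5.
  move=> i; rewrite !mxE gt_max lt_min.
  by have /andP[-> ->] := h3 i; rewrite h6.
move=> [h h']; move: h; rewrite gt_max lt_min => /andP[/andP[h1 h2] /andP[h3 h4]].
split; split; rewrite ?h1 ?h2 ?h3 ?h4 // => i; have := h' i;
  by rewrite !mxE gt_max lt_min => /andP[/andP[e1 e2] /andP[e3 e4]]; rewrite ?e1 ?e2 ?e3 ?e4.
Qed.

Definition boxes : set (set XT) := [set A | exists a b u v, A = box a b u v].

Lemma boxes_setI_closed : setI_closed boxes.
Proof.
move=> _ _ [a [b [u [v ->]]]] [a' [b' [u' [v' ->]]]]; rewrite boxI.
by do 4 eexists.
Qed.

Definition cube (k : nat) : set XT :=
  box (- k%:R) k%:R (const_mx (- k%:R)) (const_mx k%:R).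

Lemma cube_ge (x : R * 'rV[R]_n) : exists k : nat,
  `|x.1| < k%:R /\ forall i, `|x.2 0 i| < k%:R.
Proof.
pose s := `|x.1| + \sum_i `|x.2 0 i|.
have s0 : 0 <= s by rewrite addr_ge0// sumr_ge0.
have [k sk] : exists k : nat, s < k%:R.
  by exists (Num.bound s); exact: archi_boundP.
exists k; split => [|i]; apply: le_lt_trans sk; rewrite /s.
  by rewrite lerDl sumr_ge0.
rewrite (bigD1 i)//= addrCA lerDl addr_ge0// sumr_ge0//.
Qed.

(** The identity from the sigma-algebra generated by the boxes to the product
    sigma-algebra is measurable because each coordinate is: the slab of a
    coordinate interval is a countable union of boxes. *)
Lemma measurable_boxes : measurable = <<s boxes >>.
Proof.
apply/seteqP; split; last first.
  apply: smallest_sub; first exact: sigma_algebra_measurable.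
  by move=> _ [a [b [u [v ->]]]]; exact: measurable_box.
pose Y := g_sigma_algebraType boxes.
suff mid : measurable_fun [set: Y] (id : Y -> XT).
  by move=> A mA; have := mid measurableT A mA; rewrite setTI.
have mcup (F : nat -> set Y) : (forall k, boxes (F k)) -> measurable (\bigcup_k F k).
  by move=> bF; apply: bigcupT_measurable => k; apply: sub_sigma_algebra; exact: bF.
apply/measurable_fun_pairP; split.
  apply: (measurability _ (RGenOpens.measurableE R)) => _ [_ [a [b ->]] <-].
  rewrite setTI (_ : _ @^-1` _ = \bigcup_k box a b (const_mx (- k%:R)) (const_mx k%:R)).
    by apply: mcup => k; do 4 eexists.
  apply/seteqP; split => x /=; last by move=> [k _ [h _]]; rewrite /= in_itv.
  rewrite in_itv => h; have [k [_ k2]] := cube_ge x; exists k => //; split => //.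
  by move=> i; rewrite !mxE -ltr_norml.
apply: measurable_fun_coorP => i.
apply: (measurability _ (RGenOpens.measurableE R)) => _ [_ [a [b ->]] <-].
rewrite setTI (_ : _ @^-1` _ = \bigcup_k box (- k%:R) k%:R
  (\row_j if j == i then a else - k%:R) (\row_j if j == i then b else k%:R)).
  by apply: mcup => k; do 4 eexists.
apply/seteqP; split => x /=; last first.
  by move=> [k _ [_ /(_ i)]]; rewrite !mxE eqxx/= in_itv.
rewrite in_itv => h; have [k [k1 k2]] := cube_ge x; exists k => //; split.
  by rewrite -ltr_norml.
by move=> j; rewrite !mxE; case: eqP => [->//|_]; rewrite -ltr_norml.
Qed.

(** Second countability: the boxes with rational centre and radius [1/(m+1)]
    that stay inside an open set exhaust it. *)
Lemma open_bigcup_box (A : set (R * 'rV[R]_n)) : open A ->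
  exists (a b : nat -> R) (u v : nat -> 'rV[R]_n),
    (forall k, cbox (a k) (b k) (u k) (v k) `<=` A) /\
    A = \bigcup_k box (a k) (b k) (u k) (v k).
Proof.
move=> oA; pose I := (rat * 'rV[rat]_n * nat)%type.
pose e (i : I) : R := i.2.+1%:R^-1.
pose P (i : I) : Prop := cbox (ratr i.1.1 - e i) (ratr i.1.1 + e i)
    (map_mx ratr i.1.2 - const_mx (e i)) (map_mx ratr i.1.2 + const_mx (e i)) `<=` A.
pose J (k : nat) := if unpickle k is Some i then
   if pselect (P i) then Some i else None else None.
exists (fun k => if J k is Some i then ratr i.1.1 - e i else 1).
exists (fun k => if J k is Some i then ratr i.1.1 + e i else 0).
exists (fun k => if J k is Some i then map_mx ratr i.1.2 - const_mx (e i) else 0).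
exists (fun k => if J k is Some i then map_mx ratr i.1.2 + const_mx (e i) else 0).
match goal with |- ?H /\ _ => have H1 : H end.
  move=> k; rewrite /J; case: (unpickle k) => [i|]; last first.
    by move=> p [/andP[h1 h2] _]; have := le_trans h1 h2; rewrite lt_geF.
  case: pselect => [Pi|nPi] /=; first exact: Pi.
  move=> p [/andP[h1 h2] h3].
  by have := le_trans h1 h2; rewrite lt_geF.
split=> //; apply/seteqP; split; last first.
  by move=> p [k _ /sub_box_cbox]; exact: H1.
move=> p Ap.
have /nbhs_ballP[r /= r0 rA] : nbhs p A by move: oA; rewrite openE; exact.
have [m mr] : exists m : nat, m.+1%:R^-1 < r / 2.
  have r20 : 0 < r / 2 by rewrite divr_gt0.
  have [N _ /(_ N (leqnn _))/= ?] := near_infty_natSinv_lt (PosNum r20).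
  by exists N.
set d : R := m.+1%:R^-1; have d0 : 0 < d by rewrite invr_gt0.
have q1 (x : R) : exists q : rat, x - d < ratr q < x + d.
  have [q] := @rat_in_itvoo R (x - d) (x + d) ltac:(lra).
  by rewrite in_itv /= => h; exists q.
have [q hq] := q1 p.1.
have [w hw] : exists w : 'rV[rat]_n, forall i, p.2 0 i - d < ratr (w 0 i) < p.2 0 i + d.
  have /choice[f hf] := fun i => q1 (p.2 0 i).
  by exists (\row_i f i) => i; rewrite mxE.
have Pi : P (q, w, m).
  move=> z [/= /andP[z1 z2] hz]; apply: rA; split.
    rewrite /= /ball /= ltr_norml; move: mr z1 z2 hq.
    rewrite /e /= -/d => mr z1 z2 /andP[h1 h2].
    by apply/andP; split; lra.
  split=> // i j; rewrite (ord1 i) /ball /= ltr_norml; have := hz j; rewrite !mxE.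
  move: (hw j) mr; rewrite /e /= -/d => /andP[h1 h2] mr /andP[h3 h4].
  by apply/andP; split; lra.
exists (pickle (q, w, m)) => //; rewrite /J pickleK; case: pselect => //= _.
split; rewrite /e /= -/d.
  by move: hq => /andP[h1 h2]; apply/andP; split; lra.
by move=> i; rewrite !mxE; move: (hw i) => /andP[h1 h2]; apply/andP; split; lra.
Qed.

Lemma open_measurable_rV (A : set (R * 'rV[R]_n)) : open A -> measurable (A : set XT).
Proof.
move=> /open_bigcup_box[a [b [u [v [_ ->]]]]].
by apply: bigcupT_measurable => k; exact: measurable_box.
Qed.

Lemma continuous_measurable_rV (f : R * 'rV[R]_n -> R) :
  (forall p, {for p, continuous f}) -> measurable_fun setT (f : XT -> measurableTypeR R).
Proof.
move=> cf; apply: (measurability _ (RGenOpens.measurableE R)) => _ [_ [a [b ->]] <-].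
rewrite setTI; apply: open_measurable_rV; apply: open_comp => [p _|]; first exact: cf.
exact: interval_open.
Qed.

Lemma compact_cbox a b u v : compact (cbox a b u v).
Proof.
have -> : cbox a b u v = `[a, b]%classic `*`
    [set x : 'rV[R]_n | forall i, `[u 0 i, v 0 i]%classic (x 0 i)].
  apply/seteqP; split => p [h1 h2]; split.
  - by rewrite /= in_itv.
  - by move=> i /=; rewrite in_itv; exact: h2.
  - by move: h1; rewrite /= in_itv.
  - by move=> i; have := h2 i; rewrite /= in_itv.
apply: compact_setX; first exact: segment_compact.
have := @rV_compact R n (fun i => `[u 0 i, v 0 i]%classic).
by apply => i; exact: segment_compact.
Qed.

End boxes.

(** * Integrals of derivatives of compactly supported functions *)

Section line_integrals.
Context (R : realType).
Local Notation leb := (@lebesgue_measure R).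

Lemma integral_derivative0 (g g' : R -> R) (k : R) : 0 < k ->
  (forall s : R, is_derive s 1 g (g' s)) -> continuous g' ->
  (forall s, k <= `|s| -> g s = 0 /\ g' s = 0) ->
  (\int[leb]_s (g' s)%:E = 0)%E.
Proof.
move=> k0 dg cg' sg.
have -> : (\int[leb]_s (g' s)%:E = \int[leb]_(s in `[(- k)%R, k]) (g' s)%:E)%E.
  rewrite [RHS]integral_mkcond; apply: eq_integral => s _.
  rewrite patchE; case: ifPn => // /negP; rewrite inE /= in_itv /= => h.
  by rewrite (sg s _).2// leNgt ltr_norml; apply/negP => /andP[? ?]; apply: h; rewrite !ltW.
have cg : continuous g.
  by move=> s; apply/differentiable_continuous/derivable1_diffP; have [] := dg s.
rewrite (@continuous_FTC2 _ g' g).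
- have [/= gk _] : g k = 0 /\ g' k = 0 by apply: sg; rewrite ger0_norm// ltW.
  have [/= gNk _] : g (- k) = 0 /\ g' (- k) = 0 by apply: sg; rewrite normrN ger0_norm// ltW.
  by rewrite gk gNk subee.
- lra.
- by apply: continuous_subspaceT.
- split.
  + by move=> s _; have [] := dg s.
  + by apply: cvg_at_right_filter; exact: cg.
  + by apply: cvg_at_left_filter; exact: cg.
- by move=> s _; rewrite derive1E; have [_ ->] := dg s.
Qed.

Lemma is_derive_line (V : normedModType R) (f : V -> R) (x v : V) (s df : R) :
  is_derive (x + s *: v) v f df -> is_derive s 1 (fun s => f (x + s *: v)) df.
Proof.
have E : (fun h : R => h^-1 *: (((fun s => f (x + s *: v)) \o shift s) (h *: 1) -
      f (x + s *: v))) =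
    (fun h : R => h^-1 *: ((f \o shift (x + s *: v)) (h *: v) - f (x + s *: v))).
  apply/funext => h /=; congr (_ *: (f _ - _)).
  by rewrite [h *: 1]mulr1 scalerDl addrCA.
move=> [df1 df2]; split; first by rewrite /derivable E.
by rewrite -df2 /derive E.
Qed.

(** A class of integrable functions that, unlike continuity with compact
    support, passes to slices without topological arguments. *)
Definition cube_supported n (G : 'rV[R]_n -> R) (k : nat) :=
  [/\ measurable_fun setT (G : 'rV[R]_n -> measurableTypeR R),
      exists C, forall x, `|G x| <= C &
      forall (x : 'rV[R]_n) i, k%:R <= `|x 0 i| -> G x = 0].

Let Ik (k : nat) : set (measurableTypeR R) := `](- k%:R), k%:R[%classic.

Definition cube_rV n k : set 'rV[R]_n := [set x : 'rV[R]_n | forall i, Ik k (x 0 i)].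
Arguments cube_rV : clear implicits.

Lemma measurable_cube_rV n k : measurable (cube_rV n k).
Proof.
have -> : cube_rV n k = \bigcap_(i in [set: 'I_n])
    ((fun x : 'rV[R]_n => x 0 i : measurableTypeR R) @^-1` Ik k).
  by apply/seteqP; split => x /= h i; [move=> _|]; exact: h.
apply: fin_bigcap_measurable => // i _.
by rewrite -[X in measurable X]setTI; apply: measurable_coor => //; exact: measurable_itv.
Qed.

Lemma cube_rV_lty n k : (lebesgue_rV R n (cube_rV n k) < +oo)%E.
Proof.
rewrite /cube_rV (@lebesgue_rV_box R n (fun=> Ik k)); last by move=> i; exact: measurable_itv.
rewrite ltey_eq; apply/orP; left.
elim/big_ind : _ => [//|x y|i _]; first exact: fin_numM.
by rewrite /Ik lebesgue_measure_itv; case: ifP.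
Qed.

Lemma cube_lty n k : (lebesgue_time_space R n (@cube R n k) < +oo)%E.
Proof.
have -> : @cube R n k = Ik k `*` cube_rV n k.
  apply/seteqP; split => p [p1 p2]; split.
  - by rewrite /Ik /= in_itv.
  - by move=> i; have := p2 i; rewrite !mxE /Ik /= in_itv.
  - by move: p1; rewrite /Ik /= in_itv.
  - by move=> i; have := p2 i; rewrite !mxE /Ik /= in_itv.
have mI : measurable (Ik k) by exact: measurable_itv.
have := product_measure1E leb (lebesgue_rV R n) mI (@measurable_cube_rV n k).
rewrite /lebesgue_time_space /= => ->.
rewrite ltey_eq fin_numM//; first by rewrite /Ik lebesgue_measure_itv; case: ifP.
by rewrite ge0_fin_numE// cube_rV_lty.
Qed.

Lemma cube_supported_slice n (F : measurableTypeR R * 'rV[R]_n -> R) k (t : R) :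
  measurable_fun setT (F : _ -> measurableTypeR R) -> (exists C, forall p, `|F p| <= C) ->
  (forall (p : measurableTypeR R * 'rV[R]_n) i, k%:R <= `|p.2 0 i| -> F p = 0) ->
  cube_supported (fun x => F (t, x)) k.
Proof.
move=> mF [C FC] sF; split.
- exact: (measurableT_comp mF (pair1_measurable t)).
- by exists C.
- by move=> x i h; apply: (sF (t, x) i).
Qed.

Definition cube_supported2 n (F : measurableTypeR R * 'rV[R]_n -> R) (k : nat) :=
  [/\ measurable_fun setT (F : _ -> measurableTypeR R),
      exists C, forall p, `|F p| <= C,
      forall p, k%:R <= `|p.1| -> F p = 0 &
      forall (p : measurableTypeR R * 'rV[R]_n) i, k%:R <= `|p.2 0 i| -> F p = 0].

Lemma cube_supported2_integrable n (F : measurableTypeR R * 'rV[R]_n -> R) k :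
  cube_supported2 F k ->
  (lebesgue_time_space R n).-integrable setT (EFin \o F).
Proof.
move=> [mF [C FC] s1 s2].
pose Q : set (measurableTypeR R * 'rV[R]_n) := @cube R n k.
have mQ : measurable Q by exact: measurable_box.
have FQ : F = F \_ Q.
  apply/funext => p; rewrite patchE; case: ifPn => // /negP; rewrite inE => nQ.
  apply: contrapT => Fp; apply: nQ; split.
    by rewrite -ltr_norml ltNge; apply/negP => /s1.
  by move=> i; rewrite !mxE -ltr_norml ltNge; apply/negP => /s2.
have Qoo : (lebesgue_time_space R n Q < +oo)%E := cube_lty n k.
rewrite FQ -restrict_EFin; apply/(integrable_mkcond _ mQ).
apply: measurable_bounded_integrable => //; first exact: measurable_funS mF.
by exists C; split; [exact: num_real|move=> M CM x _; exact: le_trans (FC x) (ltW CM)].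
Qed.

Lemma integral_time_lines0 n (F : measurableTypeR R * 'rV[R]_n -> R) k : cube_supported2 F k ->
  (forall x, (\int[leb]_t (F (t, x))%:E = 0)%E) ->
  (\int[lebesgue_time_space R n]_p (F p)%:E = 0)%E.
Proof.
move=> sF F0; rewrite -(integral21_prod_meas1 (cube_supported2_integrable sF)) /=.
by apply: integral0_eq => x _; exact: F0.
Qed.

Lemma integral_slices0 n (F : measurableTypeR R * 'rV[R]_n -> R) k : cube_supported2 F k ->
  (forall t, (\int[lebesgue_rV R n]_x (F (t, x))%:E = 0)%E) ->
  (\int[lebesgue_time_space R n]_p (F p)%:E = 0)%E.
Proof.
move=> sF F0; rewrite -(integral12_prod_meas1 (cube_supported2_integrable sF)) /=.
by apply: integral0_eq => x _; exact: F0.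
Qed.

(** Induction on the dimension: the coordinate that [consrV] adds is either the
    direction of the lines, or constant along them. *)
Lemma integral_lines0 n (G : 'rV[R]_n -> R) k (i : 'I_n) : cube_supported G k ->
  (forall x, (\int[leb]_s (G (x + s *: delta_mx 0 i))%:E = 0)%E) ->
  (\int[lebesgue_rV R n]_x (G x)%:E = 0)%E.
Proof.
elim: n G i => [|n IH] G i sG G0; first by case: i {G0}.
pose F (p : measurableTypeR R * 'rV[R]_n) := G (consrV p).
have [mG [C GC] s0] := sG.
have sF : cube_supported2 F k.
  split.
  - exact: (measurableT_comp mG (@measurable_consrV R n)).
  - by exists C => p; exact: GC.
  - by move=> p h; apply: (s0 _ ord0); rewrite mxE unlift_none.
  - by move=> p j h; apply: (s0 _ (lift ord0 j)); rewrite mxE liftK.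
have -> : (\int[lebesgue_rV R n.+1]_x (G x)%:E =
    \int[lebesgue_time_space R n]_p (F p)%:E)%E.
  have := @integral_pushforward _ _ _ _ R _ (@measurable_consrV R n)
    (lebesgue_time_space R n) setT (EFin \o G) _ (cube_supported2_integrable sF) measurableT.
  by apply; exact/measurable_EFinP.
have consD (a s : R) (x : 'rV[R]_n) : consrV (a + s, x) = consrV (a, x) + s *: delta_mx 0 ord0.
  apply/rowP => j; rewrite !mxE eqxx /=; case: unliftP => [j' ->|->] /=.
    by rewrite mulr0 addr0.
  by rewrite mulr1.
have consL (a s : R) (x : 'rV[R]_n) j :
    consrV (a, x + s *: delta_mx 0 j) = consrV (a, x) + s *: delta_mx 0 (lift ord0 j).
  apply/rowP => j0; rewrite !mxE eqxx /=; case: unliftP => [j' ->|->] /=.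
    by rewrite !mxE eqxx (inj_eq lift_inj).
  by rewrite mulr0 addr0.
have [j ij|i0] := unliftP ord0 i; [rewrite ij in G0|rewrite i0 in G0].
  apply: (integral_slices0 sF) => t.
  apply: (IH (fun x => F (t, x)) j).
    by have [? ? ? ?] := sF; exact: cube_supported_slice.
  move=> x; rewrite -[RHS](G0 (consrV (t, x))).
  by apply: eq_integral => s _; rewrite /F consL.
apply: (integral_time_lines0 sF) => x.
rewrite -[RHS](G0 (consrV (0, x))); apply: eq_integral => t _.
by rewrite /F -[t in LHS]add0r consD.
Qed.

End line_integrals.

Lemma is_derive_near0 (R : realType) (V : normedModType R) (f : V -> R) (x v : V) (df : R) :
  is_derive x v f df -> (\near x, f x = 0) -> df = 0.
Proof.
move=> [_ <-] f0; rewrite (@near_eq_derive _ _ _ f (cst 0))//.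
exact: derive_cst.
Qed.

Section compact_support.
Context (R : realType) (n : nat).
Local Notation mu := (lebesgue_time_space R n).
Local Notation XT := (R * 'rV[R]_n)%type.
Implicit Types (F Ft Fx : XT -> R) (K : set XT) (p : XT).

Lemma compact_continuous_bounded F K : compact K -> (forall p, {for p, continuous F}) ->
  exists C, forall p, K p -> `|F p| <= C.
Proof.
move=> cK cF; have : compact (F @` K).
  by apply: continuous_compact cK; apply: continuous_subspaceT => p; exact: cF.
move=> /compact_bounded[C [_ hC]]; exists (C + 1) => p Kp.
by apply: hC; [rewrite ltrDl|exists p].
Qed.

Lemma near_support0 F K p : compact K -> (forall p, ~ K p -> F p = 0) -> ~ K p ->
  \forall q \near p, F q = 0.
Proof.
move=> cK F0 nKp; have oK : open (~` K).
  by apply: closed_openC; apply: compact_closed cK; exact: norm_hausdorff.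
have : nbhs p (~` K) by move: oK; rewrite openE; exact.
by apply: filterS => q; exact: F0.
Qed.

Lemma continuous_fst_coor p : {for p, continuous (fst : XT -> R)}.
Proof. by apply: cvg_fst. Qed.

Lemma continuous_snd_coor i p : {for p, continuous (fun q : XT => q.2 0 i)}.
Proof.
apply: (@continuous_comp _ _ _ (snd : XT -> 'rV[R]_n) (fun x : 'rV[R]_n => x 0 i)).
  exact: cvg_snd.
exact: coord_continuous.
Qed.

Lemma continuous_pair (Y : topologicalType) (f : Y -> R) (g : Y -> 'rV[R]_n) (y : Y) :
  {for y, continuous f} -> {for y, continuous g} ->
  {for y, continuous (fun z => (f z, g z))}.
Proof. by move=> cf cg; have := cvg_pair cf cg; exact. Qed.

Lemma compact_sub_cube K : compact K -> exists k : nat, forall p, K p ->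
  `|p.1| < k%:R /\ forall i, `|p.2 0 i| < k%:R.
Proof.
move=> cK; have [C0 h0] := compact_continuous_bounded cK continuous_fst_coor.
have /choice[C hC] := fun i =>
  compact_continuous_bounded cK (fun p => @continuous_snd_coor i p).
pose s := `|C0| + \sum_i `|C i|.
have s0 : 0 <= s by rewrite addr_ge0// sumr_ge0.
exists (Num.bound s) => p Kp; split => [|i]; apply: le_lt_trans (archi_boundP s0).
  by rewrite (le_trans (h0 p Kp))// (le_trans (ler_norm _))// /s lerDl sumr_ge0.
rewrite (le_trans (hC i p Kp))// (le_trans (ler_norm _))// /s (bigD1 i)//=.
by rewrite addrCA lerDl addr_ge0// sumr_ge0.
Qed.

Lemma cube_supported_compact F K : compact K -> (forall p, {for p, continuous F}) ->
  (forall p, ~ K p -> F p = 0) -> exists k, cube_supported2 F k.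
Proof.
move=> cK cF F0; have [k hk] := compact_sub_cube cK.
have [C hC] := compact_continuous_bounded cK cF.
exists k; split.
- exact: continuous_measurable_rV.
- exists `|C| => p; have [Kp|nKp] := pselect (K p).
    by rewrite (le_trans (hC p Kp))// ler_norm.
  by rewrite F0// normr0.
- by move=> p h; apply: F0 => /hk[]; rewrite ltNge h.
- by move=> p i h; apply: F0 => /hk[_ /(_ i)]; rewrite ltNge h.
Qed.

(** The integral over each line in the time direction is zero by the fundamental
    theorem of calculus; Fubini integrates over the lines. *)
Lemma integral_dt0 F Ft K : compact K -> (forall p, ~ K p -> F p = 0) ->
  (forall p, {for p, continuous Ft}) ->
  (forall (t : R) x, is_derive t 1 (fun s => F (s, x)) (Ft (t, x))) ->
  mu.-integrable setT (EFin \o Ft) /\ (\int[mu]_p (Ft p)%:E = 0)%E.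
Proof.
move=> cK F0 cFt dF.
have Ft0 p : ~ K p -> Ft p = 0.
  case: p => t x nK; apply: (is_derive_near0 (dF t x)).
  have := near_support0 cK F0 nK; case=> -[A B] /= [A0 B0] AB.
  apply: filterS A0 => s As; apply: (AB (s, x)); split => //=.
  exact: nbhs_singleton.
have [k sF] := cube_supported_compact cK cFt Ft0.
split; first exact: cube_supported2_integrable sF.
apply: (integral_time_lines0 sF) => x.
have [k' hk'] := compact_sub_cube cK.
apply: (@integral_derivative0 _ (fun s : R => F (s, x)) (fun s : R => Ft (s, x)) (k'%:R + 1)).
- by rewrite ltr_wpDl.
- move=> s; apply: (@continuous_comp _ _ _ (fun s : R => (s, x)) Ft); last exact: cFt.
  by apply: continuous_pair; [exact: cvg_id|exact: cvg_cst].
- move=> s h; have nK : ~ K (s, x).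
    by move=> /hk'[/= + _]; rewrite ltNge (le_trans _ h)// lerDl.
  by rewrite F0 ?Ft0.
Qed.

(** As [integral_dt0]; the lines in a space direction are handled inside each
    time slice. *)
Lemma integral_dx0 F Fx K (i : 'I_n) : compact K -> (forall p, ~ K p -> F p = 0) ->
  (forall p, {for p, continuous Fx}) ->
  (forall (t : R) x, is_derive x (delta_mx 0 i) (fun y => F (t, y)) (Fx (t, x))) ->
  mu.-integrable setT (EFin \o Fx) /\ (\int[mu]_p (Fx p)%:E = 0)%E.
Proof.
move=> cK F0 cFx dF.
have Fx0 p : ~ K p -> Fx p = 0.
  case: p => t x nK; apply: (is_derive_near0 (dF t x)).
  have := near_support0 cK F0 nK; case=> -[A B] /= [A0 B0] AB.
  apply: filterS B0 => s Bs; apply: (AB (t, s)); split => //=.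
  exact: nbhs_singleton.
have [k sF] := cube_supported_compact cK cFx Fx0.
split; first exact: cube_supported2_integrable sF.
apply: (integral_slices0 sF) => t.
have [? ? ? ?] := sF.
apply: (@integral_lines0 _ _ (fun x => Fx (t, x)) k i); first exact: cube_supported_slice.
move=> x; have [k' hk'] := compact_sub_cube cK.
apply: (@integral_derivative0 _ (fun s => F (t, x + s *: delta_mx 0 i))
  (fun s => Fx (t, x + s *: delta_mx 0 i)) (k'%:R + `|x 0 i| + 1)).
- by rewrite ltr_wpDl// addr_ge0.
- by move=> s; apply: (@is_derive_line _ _ (fun y => F (t, y))); exact: dF.
- move=> s; apply: (@continuous_comp _ _ _ (fun s : R => (t, x + s *: delta_mx 0 i)) Fx);
    last exact: cFx.
  apply: continuous_pair; first exact: cvg_cst.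
  by apply: cvgD; [exact: cvg_cst|apply: cvgZr_tmp; exact: cvg_id].
- move=> s h; have nK : ~ K (t, x + s *: delta_mx 0 i).
    move=> /hk'[/= _ /(_ i)]; rewrite !mxE !eqxx mulr1 => h2.
    have := ler_normB (x 0 i + s) (x 0 i); rewrite addrAC subrr add0r; lra.
  by rewrite F0 ?Fx0.
Qed.

End compact_support.

(** * Test functions and integration by parts *)

Section test_functions.
Context (R : realType) (n : nat) (D : set (R * 'rV[R]_n)).
Local Notation mu := (lebesgue_time_space R n).
Local Notation XT := (R * 'rV[R]_n)%type.

(** The derivatives are part of the data.  One time derivative and two pure space
    derivatives are what the operator needs; this leaves room for piecewise
    polynomial test functions. *)
Record test_function := TestFunction {
  tf :> XT -> R;
  tf_t : XT -> R;
  tf_x : 'I_n -> XT -> R;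
  tf_xx : 'I_n -> XT -> R;
  tf_support : set XT;
  tf_compact : compact tf_support;
  tf_sub : tf_support `<=` D;
  tf_out : forall p, ~ tf_support p -> tf p = 0;
  tf_cont : forall p, {for p, continuous tf};
  tf_t_cont : forall p, {for p, continuous tf_t};
  tf_x_cont : forall i p, {for p, continuous (tf_x i)};
  tf_xx_cont : forall i p, {for p, continuous (tf_xx i)};
  tf_dt : forall (t : R) x, is_derive t 1 (fun s => tf (s, x)) (tf_t (t, x));
  tf_dx : forall i (t : R) x,
    is_derive x (delta_mx 0 i) (fun y => tf (t, y)) (tf_x i (t, x));
  tf_dxx : forall i (t : R) x,
    is_derive x (delta_mx 0 i) (fun y => tf_x i (t, y)) (tf_xx i (t, x)) }.

Lemma line_near (K : set XT) (F : XT -> R) t x : compact K ->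
  (forall p, ~ K p -> F p = 0) -> ~ K (t, x) ->
  (\forall s \near t, F (s, x) = 0) /\ (\forall y \near x, F (t, y) = 0).
Proof.
move=> cK F0 nK; have := near_support0 cK F0 nK; case=> -[A B] /= [A0 B0] AB.
split; [apply: filterS A0 => s As|apply: filterS B0 => y Bs].
  by apply: (AB (s, x)); split => //=; exact: nbhs_singleton.
by apply: (AB (t, y)); split => //=; exact: nbhs_singleton.
Qed.

Section outside.
Variable Psi : test_function.
Let K := tf_support Psi.

Lemma tf_t_out p : ~ K p -> tf_t Psi p = 0.
Proof.
case: p => t x nK; apply: (is_derive_near0 (tf_dt Psi t x)).
by have [] := line_near (@tf_compact Psi) (@tf_out Psi) nK.
Qed.

Lemma tf_x_out i p : ~ K p -> tf_x Psi i p = 0.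
Proof.
case: p => t x nK; apply: (is_derive_near0 (tf_dx Psi i t x)).
by have [] := line_near (@tf_compact Psi) (@tf_out Psi) nK.
Qed.

Lemma tf_xx_out i p : ~ K p -> tf_xx Psi i p = 0.
Proof.
case: p => t x nK; apply: (is_derive_near0 (tf_dxx Psi i t x)).
by have [] := line_near (@tf_compact Psi) (@tf_x_out i) nK.
Qed.

Lemma continuous_supported (F : XT -> R) : (forall p, ~ K p -> F p = 0) ->
  (forall p, D p -> {for p, continuous F}) -> forall p, {for p, continuous F}.
Proof.
move=> F0 cF p; have [Kp|nKp] := pselect (K p); first exact/cF/tf_sub/Kp.
rewrite /prop_for /continuous_at (F0 _ nKp); apply: cvg_near_cst.
exact: near_support0 (@tf_compact Psi) F0 nKp.
Qed.

(** The integrand is the time derivative of [f Psi], which extends by zero to a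
    compactly supported function whatever [f] does near the boundary of [D]. *)
Lemma integral_by_parts_t (f ft : XT -> R) :
  (forall p, D p -> {for p, continuous f}) ->
  (forall p, D p -> {for p, continuous ft}) ->
  (forall (t : R) x, D (t, x) -> is_derive t 1 (fun s => f (s, x)) (ft (t, x))) ->
  mu.-integrable setT (EFin \o (fun p => ft p * Psi p + f p * tf_t Psi p)) /\
  (\int[mu]_p (ft p * Psi p + f p * tf_t Psi p)%:E = 0)%E.
Proof.
move=> cf cft df; apply: (@integral_dt0 _ _ (fun p => f p * Psi p) _ K).
- exact: tf_compact.
- by move=> p nK; rewrite tf_out// mulr0.
- apply: continuous_supported => p.
    by move=> nK; rewrite tf_out// tf_t_out// !mulr0 addr0.
  move=> Dp; apply: cvgD; apply: cvgM.
  + exact: cft.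
  + exact: tf_cont.
  + exact: cf.
  + exact: tf_t_cont.
- move=> t x; have [Kp|nK] := pselect (K (t, x)).
    have := df _ _ (tf_sub Kp); have := tf_dt Psi t x => d1 d2.
    by apply: is_derive_eq; rewrite /GRing.scale /=; ring.
  rewrite tf_out// tf_t_out// !mulr0 addr0.
  apply: (@near_eq_is_derive _ _ _ (cst 0)).
  have := line_near (@tf_compact Psi) (@tf_out Psi) nK => -[+ _].
  by apply: filterS => s ->; rewrite mulr0.
Qed.

(** The second derivative is moved in a single step, the integrand being the
    derivative of [fx Psi - f Psi_x]. *)
Lemma integral_by_parts_xx (i : 'I_n) (f fx fxx : XT -> R) :
  (forall p, D p -> {for p, continuous f}) ->
  (forall p, D p -> {for p, continuous fxx}) ->
  (forall (t : R) x, D (t, x) ->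
     is_derive x (delta_mx 0 i) (fun y => f (t, y)) (fx (t, x))) ->
  (forall (t : R) x, D (t, x) ->
     is_derive x (delta_mx 0 i) (fun y => fx (t, y)) (fxx (t, x))) ->
  mu.-integrable setT (EFin \o (fun p => fxx p * Psi p - f p * tf_xx Psi i p)) /\
  (\int[mu]_p (fxx p * Psi p - f p * tf_xx Psi i p)%:E = 0)%E.
Proof.
move=> cf cfxx df dfx.
apply: (@integral_dx0 _ _ (fun p => fx p * Psi p - f p * tf_x Psi i p) _ K i).
- exact: tf_compact.
- by move=> p nK; rewrite tf_out// tf_x_out// !mulr0 subr0.
- apply: continuous_supported => p.
    by move=> nK; rewrite tf_out// tf_xx_out// !mulr0 subr0.
  move=> Dp; apply: cvgB; apply: cvgM.
  + exact: cfxx.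
  + exact: tf_cont.
  + exact: cf.
  + exact: tf_xx_cont.
- move=> t x; have [Kp|nK] := pselect (K (t, x)).
    have := df _ _ (tf_sub Kp); have := dfx _ _ (tf_sub Kp).
    have := tf_dx Psi i t x; have := tf_dxx Psi i t x => d1 d2 d3 d4.
    apply: is_derive_eq; rewrite /GRing.scale /=; ring.
  rewrite tf_out// tf_xx_out// !mulr0 subr0.
  apply: (@near_eq_is_derive _ _ _ (cst 0)).
  have [_ h1] := line_near (@tf_compact Psi) (@tf_out Psi) nK.
  have [_ h2] := line_near (@tf_compact Psi) (@tf_x_out i) nK.
  by near do rewrite /= (near h1) ?(near h2) ?mulr0 ?subr0 //.
Unshelve. all: by end_near. Qed.

End outside.
End test_functions.

(** * Weak form of the adjoint Schrodinger operator *)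

Section cylinder.
Context (R : realType) (n : nat) (T : R) (Omega : set 'rV[R]_n).
Hypotheses (oO : open Omega) (bO : bounded_set Omega).
Local Notation mu := (lebesgue_time_space R n).
Local Notation XT := (measurableTypeR R * 'rV[R]_n)%type.
Local Notation D := (cylinder T Omega).

Lemma open_cylinder : open (D : set (R * 'rV[R]_n)).
Proof.
have -> : (D : set (R * 'rV[R]_n)) = (fst @^-1` `]0, T[%classic) `&` (snd @^-1` Omega).
  by [].
apply: openI.
  by apply: open_comp => [p _|]; [exact: cvg_fst|exact: interval_open].
by apply: open_comp => [p _|//]; exact: cvg_snd.
Qed.

Lemma measurable_cylinder : measurable (D : set XT).
Proof. exact: open_measurable_rV open_cylinder. Qed.

Lemma ler_coor (x : 'rV[R]_n) i : `|x 0 i| <= `|x|.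
Proof. by rewrite [leRHS]mx_normrE; apply: (le_bigmax _ _ (0, i)). Qed.

Lemma cylinder_lty : (mu D < +oo)%E.
Proof.
have [M [_ hM]] := bO.
have DM x i : Omega x -> `|x 0 i| <= M + 1.
  by move=> Ox; rewrite (le_trans (ler_coor _ _))// hM// ltrDl.
have s0 : 0 <= `|T| + `|M| + 1 by rewrite !addr_ge0.
apply: le_lt_trans (cube_lty R n (Num.bound (`|T| + `|M| + 1))).
apply: le_measure; rewrite ?inE.
- exact: measurable_cylinder.
- exact: measurable_box.
have := archi_boundP s0; set k := _%:R => hk.
have [T1 [T2 [M1 M2]]] : - `|T| <= T /\ T <= `|T| /\ - `|M| <= M /\ M <= `|M|.
  by rewrite !lerNnormlW// !ler_norm.
move=> p [/=]; rewrite in_itv /= => /andP[p0 pT] Op; split.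
  by apply/andP; split; have := normr_ge0 M; lra.
move=> i; rewrite !mxE -ltr_norml; apply: le_lt_trans (DM _ i Op) _.
have := normr_ge0 T; lra.
Qed.

Let mD := measurable_cylinder.

Lemma test_bounded_real_L2 (F : R * 'rV[R]_n -> R) K : compact K ->
  (forall p, ~ K p -> F p = 0) -> (forall p, {for p, continuous F}) ->
  real_L2 mu D F /\ exists C, forall p, `|F p| <= C.
Proof.
move=> cK F0 cF; have [k [mF [C FC] _ _]] := cube_supported_compact cK cF F0.
split; last by exists C.
apply: (ae_bounded_real_L2 mD cylinder_lty (C := C)).
  exact: measurable_funS mF.
by apply: aeW => p _; exact: FC.
Qed.

Context (V : XT -> R) (LV : Linfty mu D V).
Implicit Type Psi : test_function D.

Lemma L2_test Psi : L2 mu D (toC Psi).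
Proof.
have [h _] := test_bounded_real_L2 (@tf_compact _ _ _ Psi) (@tf_out _ _ _ Psi)
  (@tf_cont _ _ _ Psi).
apply/L2P => //; split=> //.
apply: (ae_bounded_real_L2 mD cylinder_lty (C := 0)); first exact: measurable_cst.
by apply: aeW => p _; rewrite normr0.
Qed.

(** The Schrodinger operator of a real test function, in terms of the
    derivatives recorded with it. *)
Definition schrodinger_test Psi : XT -> R[i] := fun p =>
  Complex (2^-1 * (\sum_i tf_xx Psi i p) - V p * Psi p) (tf_t Psi p).

Lemma L2_schrodinger_test Psi : L2 mu D (schrodinger_test Psi).
Proof.
have [hP [C PC]] := test_bounded_real_L2 (@tf_compact _ _ _ Psi) (@tf_out _ _ _ Psi)
  (@tf_cont _ _ _ Psi).
have [ht _] := test_bounded_real_L2 (@tf_compact _ _ _ Psi) (@tf_t_out _ _ _ Psi)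
  (@tf_t_cont _ _ _ Psi).
have hx i := (test_bounded_real_L2 (@tf_compact _ _ _ Psi) (@tf_xx_out _ _ _ Psi i)
  (@tf_xx_cont _ _ _ Psi i)).1.
have hsum : real_L2 mu D (fun p => \sum_i tf_xx Psi i p).
  elim: (index_enum _) => [|i r IH].
    under eq_fun do rewrite big_nil.
    have := real_L2Z mD 0 hP; congr real_L2; apply/funext => p; exact: mul0r.
  under eq_fun do rewrite big_cons.
  exact: (real_L2D mD (hx i) IH).
have [mV [M VM]] := LV.
have hV : real_L2 mu D (fun p => V p * Psi p).
  apply: (ae_bounded_real_L2 mD cylinder_lty (C := `|M| * C)).
    by apply: measurable_funM => //; case: hP.
  apply: filterS VM => p + Dp => /(_ Dp) Vp; rewrite normrM ler_pM//.
  by rewrite (le_trans Vp)// ler_norm.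
apply/L2P => //; split=> //=.
have := real_L2D mD (real_L2Z mD 2^-1 hsum) (real_L2Z mD (-1) hV).
by congr real_L2; apply/funext => p; rewrite mulN1r.
Qed.

Lemma cylinder_integral (e : R * 'rV[R]_n -> R) Psi :
  (forall p, ~ tf_support Psi p -> e p = 0) ->
  mu.-integrable setT (EFin \o e) -> (\int[mu]_p (e p)%:E = 0)%E ->
  mu.-integrable D (EFin \o e) /\ \int[mu]_(p in D) e p = 0.
Proof.
move=> e0 ie Ie; split; first exact: integrableS ie.
rewrite /Rintegral integral_mkcond -[RHS]fine0 -[in RHS]Ie; congr fine.
apply: eq_integral => p _; rewrite patchE; case: ifPn => // /negP; rewrite inE => nD.
by rewrite e0// => /tf_sub.
Qed.

Lemma C12_integral_t (f : R * 'rV[R]_n -> R) Psi : C12_zero T Omega f ->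
  let e p := dt f p * Psi p + f p * tf_t Psi p in
  mu.-integrable D (EFin \o e) /\ \int[mu]_(p in D) e p = 0.
Proof.
move=> [_ h1 [_ h2] _ _] e.
have [||t x Dp|i1 i2] := @integral_by_parts_t _ _ _ Psi f (dt f).
- by move=> p Dp; have := h2 [::] p isT Dp; congr continuous_at; apply/funext => -[].
- by move=> p Dp; have [] := h1 _ Dp.
- have [/= h _] := h1 _ Dp; rewrite /dt /= derive1E; exact: derivableP.
apply: (cylinder_integral (Psi := Psi)) i1 i2 => p nK.
by rewrite /e tf_out// tf_t_out// !mulr0 addr0.
Qed.

Lemma C12_integral_xx (f : R * 'rV[R]_n -> R) Psi i : C12_zero T Omega f ->
  let e p := dx [:: i; i] f p * Psi p - f p * tf_xx Psi i p in
  mu.-integrable D (EFin \o e) /\ \int[mu]_(p in D) e p = 0.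
Proof.
move=> [_ _ [h1 h2] _ _] e.
have [||t x Dp|t x Dp|i1 i2] :=
  @integral_by_parts_xx _ _ _ Psi i f (dx [:: i] f) (dx [:: i; i] f).
- by move=> p Dp; have := h2 [::] p isT Dp; congr continuous_at; apply/funext => -[].
- by move=> p Dp; exact: h2.
- have [/= ht Ox] := Dp; have [+ _] := h1 t ltac:(by move: ht; rewrite in_itv).
  by move=> /(_ [::] i x isT Ox); exact: derivableP.
- have [/= ht Ox] := Dp; have [+ _] := h1 t ltac:(by move: ht; rewrite in_itv).
  by move=> /(_ [:: i] i x isT Ox); exact: derivableP.
apply: (cylinder_integral (Psi := Psi)) i1 i2 => p nK.
by rewrite /e tf_out// tf_xx_out// !mulr0 subr0.
Qed.

Lemma C12_integral_laplacian (f : R * 'rV[R]_n -> R) Psi : C12_zero T Omega f ->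
  let e p := laplacian f p * Psi p - f p * (\sum_i tf_xx Psi i p) in
  mu.-integrable D (EFin \o e) /\ \int[mu]_(p in D) e p = 0.
Proof.
move=> hf e.
have -> : e = fun p => \sum_i (dx [:: i; i] f p * Psi p - f p * tf_xx Psi i p).
  by apply/funext => p; rewrite /e big_split/= sumrN -mulr_suml -mulr_sumr.
elim: (index_enum _) => [|i r [IH1 IH2]].
  under eq_fun do rewrite big_nil; split; first exact: integrable0.
  by rewrite /Rintegral integral0.
have [h1 h2] := C12_integral_xx Psi i hf.
under eq_fun do rewrite big_cons; split.
  by have := integrableD mD h1 IH1; apply: eq_integrable.
by rewrite RintegralD// h2 IH2 addr0.
Qed.

(** Formal symmetry of [i d/dt + Laplacian / 2 - V]: the two integrands differ
    by derivatives of compactly supported functions, the potential terms being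
    equal pointwise. *)
Lemma S0star_symmetric (v : XT -> R[i]) Psi : DS0star T Omega V v -> L2 mu D v ->
  L2dot mu D (S0star V v) (toC Psi) = L2dot mu D v (schrodinger_test Psi).
Proof.
move=> [hr hi LS] Lv.
have tr := C12_integral_t Psi hr; have ti := C12_integral_t Psi hi.
have xr := C12_integral_laplacian Psi hr; have xi := C12_integral_laplacian Psi hi.
have [i1 i2] := L2_cintegrable mD Lv (L2_schrodinger_test Psi).
have half : 2^-1 = (2^-1)%:C%C :> R[i] by rewrite fmorphV rmorph_nat.
rewrite /L2dot /cintegral; congr Complex.
  rewrite -(Rintegral_add0 mD 2^-1 (-1) xr ti i1); apply: eq_Rintegral => p _.
  rewrite /S0star half /schrodinger_test /toC /componentwise !partsE /=.
  move: (laplacian _ p) (laplacian _ p) (dt _ p) (dt _ p) (Re (v p)) (Im (v p)).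
  by move: (\sum_i _) (tf_t Psi p) (Psi p) (V p) => *; ring.
rewrite -(Rintegral_add0 mD 2^-1 1 xi tr i2); apply: eq_Rintegral => p _.
rewrite /S0star half /schrodinger_test /toC /componentwise !partsE /=.
move: (laplacian _ p) (laplacian _ p) (dt _ p) (dt _ p) (Re (v p)) (Im (v p)).
by move: (\sum_i _) (tf_t Psi p) (Psi p) (V p) => *; ring.
Qed.

(** The distributional form of [S^* v = w]. *)
Definition weak_Sstar (v w : XT -> R[i]) := [/\ L2 mu D v, L2 mu D w &
  forall Psi, L2dot mu D w (toC Psi) = L2dot mu D v (schrodinger_test Psi)].

Lemma closureS_weak v w : Defs.closureS T Omega V v w -> weak_Sstar v w.
Proof.
move=> [vk [dom cv cw]]; have [Lvk Lv _] := cv; have [_ Lw _] := cw.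
split=> // Psi.
have c1 := cvgL2_dot mD cw (L2_test Psi).
have c2 := cvgL2_dot mD cv (L2_schrodinger_test Psi).
set a := L2dot mu D w _ in c1 *; set b := L2dot mu D v _ in c2 *.
apply/eqP; rewrite -subr_eq0; apply/eqP/Normc.eq0_normc/le_anti; rewrite normc_ge0 andbT leNgt;
  apply/negP => ab.
have := cvgD c1 c2; rewrite addr0 => c.
have [k _ hk] := (cvgrPdist_lt _ _).1 (c _) _ ab.
have {hk} : `|0 - (normc (L2dot mu D (S0star V (vk k)) (toC Psi) - a) +
  normc (L2dot mu D (vk k) (schrodinger_test Psi) - b))| < normc (a - b).
  exact: hk (leqnn k).
rewrite sub0r normrN ger0_norm ?addr_ge0 ?normc_ge0//; apply/negP; rewrite -leNgt.
rewrite S0star_symmetric// [leRHS]addrC.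
set c0 := L2dot _ _ _ _; rewrite -[normc (c0 - a)]normcN.
have -> : a - b = (c0 - b) + - (c0 - a) by ring.
exact: le_normcD.
Qed.

End cylinder.

(** * Plateau functions *)

Section truncated_powers.
Context (R : realType).
Implicit Types (s t : R) (r : R -> R).

(** Powers of the positive part glue polynomials to zero with any finite order of
    differentiability. *)
Definition pospart t : R := (t + `|t|) / 2.

Lemma pospart_ge t : 0 <= t -> pospart t = t.
Proof. by move=> t0; rewrite /pospart ger0_norm//; lra. Qed.

Lemma pospart_le t : t <= 0 -> pospart t = 0.
Proof. by move=> t0; rewrite /pospart ler0_norm//; lra. Qed.

Lemma pospart_ge0 t : 0 <= pospart t.
Proof.
have [t0|/ltW t0] := leP 0 t; first by rewrite pospart_ge.
by rewrite pospart_le.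
Qed.

Lemma continuous_pospart : continuous pospart.
Proof.
move=> t; apply: cvgM; last exact: cvg_cst.
by apply: cvgD; [exact: cvg_id|exact: norm_continuous].
Qed.

(** At the kink the function is [t * r t] with [r] continuous, which is
    differentiable there with derivative [r 0]. *)
Lemma is_derive_pospartX n t :
  is_derive t 1 (fun s => pospart s ^+ n.+2) (n.+2%:R * pospart t ^+ n.+1).
Proof.
have [t0|t0|->] := ltrgtP t 0.
- rewrite (pospart_le (ltW t0)) expr0n mulr0.
  apply: (@near_eq_is_derive _ _ _ (cst 0)).
  near=> s; rewrite pospart_le ?expr0n//=.
  by near: s; apply: filterS (lt_nbhsl t0) => s /ltW.
- rewrite (pospart_ge (ltW t0)).
  apply: (@near_eq_is_derive _ _ _ ((@id R) ^+ n.+2)).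
    near=> s; rewrite pospart_ge ?exprfctE//=.
    by near: s; apply: filterS (lt_nbhsr t0) => s /ltW.
  by apply: is_derive_eq; rewrite /GRing.scale /= mulr1.
- have E : (fun h : R => h^-1 *: (((fun s => pospart s ^+ n.+2) \o shift 0) (h *: 1) -
      pospart 0 ^+ n.+2)) @ 0^' --> n.+2%:R * pospart 0 ^+ n.+1.
    rewrite (pospart_le (lexx 0)) !expr0n/= !mulr0n mulr0.
    have c0 : (fun h => pospart h ^+ n.+1) @ 0^' --> (0 : R).
      have : {for 0, continuous (fun h => pospart h ^+ n.+1)}.
        by apply: (@continuous_comp _ _ _ pospart (fun s => s ^+ n.+1));
          [exact: continuous_pospart|exact: exprn_continuous].
      rewrite /prop_for /continuous_at (pospart_le (lexx 0)) expr0n/= mulr0n.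
      exact: cvg_within_filter.
    apply: cvg_trans c0; apply: near_eq_cvg; near=> h.
    rewrite /= addr0 subr0 [h *: 1]mulr1 [_ ^+ n.+2]exprS /GRing.scale /=.
    have h0 : h != 0 by near: h; exact: nbhs_dnbhs_neq.
    have [hp|hn] := leP 0 h; first by rewrite (pospart_ge hp) mulrA mulVf// mul1r.
    by rewrite (pospart_le (ltW hn)) mul0r mulr0 expr0n.
  split; first by apply/cvg_ex; eexists; exact: E.
  exact: (cvg_lim _ E).
Unshelve. all: by end_near. Qed.

End truncated_powers.

Section profiles.
Context (R : realType).

Record profile (a b : R) := Profile {
  pf :> R -> R;
  pf1 : R -> R;
  pf2 : R -> R;
  pf_out : forall t, ~ (a <= t <= b) -> pf t = 0;
  pf_d : forall t : R, is_derive t 1 pf (pf1 t);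
  pf1_d : forall t : R, is_derive t 1 pf1 (pf2 t);
  pf2_cont : continuous pf2 }.

Lemma is_derive_continuous (f f' : R -> R) :
  (forall t : R, is_derive t 1 f (f' t)) -> continuous f.
Proof.
by move=> df t; apply/differentiable_continuous/derivable1_diffP; have [] := df t.
Qed.

Lemma is_derive_onem_pow0 (s : R -> R) (s1 : R) n (t : R) : is_derive t 1 s s1 ->
  is_derive t 1 (fun y => (1 - s y) ^+ n) (- (n%:R * (1 - s t) ^+ n.-1 * s1)).
Proof.
move=> h; have h0 := is_deriveB (is_derive_cst (1 : R) t 1) h.
have := is_deriveX n h0; rewrite exprfctE /GRing.scale /= sub0r mulrN; exact.
Qed.

Lemma is_derive_onem_pow (s : R -> R) (s1 : R) n (t : R) : is_derive t 1 s s1 ->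
  is_derive t 1 (fun y => 1 - (1 - s y) ^+ n.+2) (n.+2%:R * (1 - s t) ^+ n.+1 * s1).
Proof.
move=> h; have := is_deriveB (is_derive_cst (1 : R) t 1) (is_derive_onem_pow0 n.+2 h).
by rewrite sub0r opprK.
Qed.

Lemma is_derive_onem_pow1 (s s1 : R -> R) (s2 : R) n (t : R) :
  is_derive t 1 s (s1 t) -> is_derive t 1 s1 s2 ->
  is_derive t 1 (fun y => n.+2%:R * (1 - s y) ^+ n.+1 * s1 y)
   (n.+2%:R * ((1 - s t) ^+ n.+1 * s2 - n.+1%:R * (1 - s t) ^+ n * s1 t ^+ 2)).
Proof.
move=> h h1.
have h2 := is_deriveM (is_deriveM (is_derive_cst (n.+2%:R : R) t 1)
  (is_derive_onem_pow0 n.+1 h)) h1.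
have := is_derive_eq h2 (df := n.+2%:R * ((1 - s t) ^+ n.+1 * s2 -
  n.+1%:R * (1 - s t) ^+ n * s1 t ^+ 2)); apply.
by rewrite /GRing.scale /= -[(cst _ * _) t]/(n.+2%:R * (1 - s t) ^+ n.+1); ring.
Qed.

Variables (a b : R).

Let l t : R := pospart (t - a).
Let r t : R := pospart (b - t).
Let c := (b - a) ^- 6.
(** The factor [(b - a)^-6] makes [bump] at most [1]. *)
Definition bump t : R := c * (l t ^+ 3 * r t ^+ 3).
Let bump1 t : R := c * (3 * l t ^+ 2 * r t ^+ 3 - 3 * l t ^+ 3 * r t ^+ 2).
Let bump2 t : R := c * (6 * l t * r t ^+ 3 - 18 * l t ^+ 2 * r t ^+ 2 + 6 * l t ^+ 3 * r t).

Let dl n (t : R) : is_derive t 1 (fun s => l s ^+ n.+2) (n.+2%:R * l t ^+ n.+1).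
Proof.
have := @is_derive1_comp R (fun s => pospart s ^+ n.+2) (fun s => s - a) t _ _
  (is_derive_pospartX n (t - a)).
have h : is_derive t 1 (fun s : R => s - a) 1.
  by apply: is_derive_eq; rewrite subr0.
by move=> /(_ _ h); rewrite mulr1.
Qed.

Let dr n (t : R) : is_derive t 1 (fun s => r s ^+ n.+2) (- (n.+2%:R * r t ^+ n.+1)).
Proof.
have := @is_derive1_comp R (fun s => pospart s ^+ n.+2) (fun s => b - s) t _ _
  (is_derive_pospartX n (b - t)).
have h : is_derive t 1 (fun s : R => b - s) (-1).
  by apply: is_derive_eq; ring.
by move=> /(_ _ h); rewrite mulrN1.
Qed.

Let bump_d (t : R) : is_derive t 1 bump (bump1 t).
Proof.
have := dl 1 t; have := dr 1 t => h1 h2.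
by rewrite /bump; apply: is_derive_eq; rewrite /GRing.scale /= /bump1; ring.
Qed.

Let bump1_d (t : R) : is_derive t 1 bump1 (bump2 t).
Proof.
have := dl 1 t; have := dr 1 t => h1 h2.
have := dl 0 t; have := dr 0 t => h3 h4.
by rewrite /bump1; apply: is_derive_eq; rewrite /GRing.scale /= /bump2; ring.
Qed.

Let lc : continuous l.
Proof.
move=> t; apply: (@continuous_comp _ _ _ (fun s : R => s - a) (@pospart R)).
  by apply: cvgB; [exact: cvg_id|exact: cvg_cst].
exact: continuous_pospart.
Qed.

Let rc : continuous r.
Proof.
move=> t; apply: (@continuous_comp _ _ _ (fun s : R => b - s) (@pospart R)).
  by apply: cvgB; [exact: cvg_cst|exact: cvg_id].
exact: continuous_pospart.
Qed.

Let contX f n : continuous f -> continuous (fun t : R => (f t : R) ^+ n).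
Proof.
by move=> cf t; apply: (@continuous_comp _ _ _ f (fun s : R => s ^+ n));
  [exact: cf|exact: exprn_continuous].
Qed.

Let contM f g : continuous (f : R -> R) -> continuous (g : R -> R) ->
  continuous (fun t => f t * g t).
Proof. by move=> cf cg t; apply: cvgM; [exact: cf|exact: cg]. Qed.

Let bump2_cont : continuous bump2.
Proof.
apply: (contM (f := fun _ : R => c)); first by move=> t; exact: cvg_cst.
have k (z : R) : continuous (fun _ : R => z) by move=> t; exact: cvg_cst.
have c1 := contM (contM (k 6) lc) (contX (n := 3) rc).
have c2 := contM (contM (k 18) (contX (n := 2) lc)) (contX (n := 2) rc).
have c3 := contM (contM (k 6) (contX (n := 3) lc)) rc.
by move=> t; apply: cvgD (c3 t); apply: cvgB (c1 t) (c2 t).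
Qed.

Let bump_out (t : R) : ~ (a <= t <= b) -> bump t = 0.
Proof.
move=> /negP; rewrite negb_and -!ltNge /bump => /orP[h|h].
  by rewrite {1}/l pospart_le ?expr0n ?mul0r ?mulr0//; lra.
by rewrite {1}/r pospart_le ?expr0n ?mul0r ?mulr0//; lra.
Qed.

Hypothesis ab : a < b.

Lemma bump_ge0 t : 0 <= bump t.
Proof.
apply: mulr_ge0; last by rewrite mulr_ge0// exprn_ge0// pospart_ge0.
by rewrite /c invr_ge0 exprn_ge0// subr_ge0 ltW.
Qed.

Lemma bump_gt0 t : a < t < b -> 0 < bump t.
Proof.
move=> /andP[h1 h2].
rewrite /bump /c /l /r !pospart_ge ?subr_ge0 ?ltW//.
by rewrite !mulr_gt0 ?invr_gt0 ?exprn_gt0 ?subr_gt0.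
Qed.

Lemma bump_le1 t : bump t <= 1.
Proof.
have [/andP[h1 h2]|h] := pselect (a <= t <= b); last by rewrite bump_out.
have ba : 0 < b - a by rewrite subr_gt0.
rewrite /bump mulrC ler_pdivrMr ?exprn_gt0// mul1r.
have hl : l t <= b - a by rewrite /l pospart_ge; lra.
have hr : r t <= b - a by rewrite /r pospart_ge; lra.
have [l0 r0] : 0 <= l t /\ 0 <= r t by rewrite !pospart_ge0.
by rewrite (_ : 6 = 3 + 3)%N// exprD ler_pM ?exprn_ge0// ler_pXn2r// nnegrE ltW.
Qed.

(** The powers [1 - (1 - bump)^n] increase to the indicator of [(a, b)] while
    keeping the regularity and the support of [bump]. *)
Definition plateau n t : R := 1 - (1 - bump t) ^+ n.+2.

Lemma plateau_ge0 n t : 0 <= plateau n t.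
Proof.
by rewrite subr_ge0 exprn_ile1 ?subr_ge0 ?bump_le1// lerBlDr lerDl bump_ge0.
Qed.

Lemma plateau_le1 n t : plateau n t <= 1.
Proof. by rewrite lerBlDr lerDl exprn_ge0// subr_ge0 bump_le1. Qed.

Lemma plateau_out n t : ~ (a < t < b) -> plateau n t = 0.
Proof.
move=> h; have b0 : bump t = 0.
  have [/andP[h1 h2]|] := pselect (a <= t <= b); last exact: bump_out.
  have [t1|t1] : t = a \/ t = b.
    have [->|ta] := eqVneq t a; [by left|right].
    apply/eqP; rewrite eq_le h2 leNgt; apply/negP => tb.
    by apply: h; rewrite tb lt_neqAle eq_sym ta h1.
  - by rewrite /bump /l t1 subrr pospart_le ?expr0n ?mul0r ?mulr0.
  - by rewrite /bump /r t1 subrr pospart_le ?expr0n ?mul0r ?mulr0.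
by rewrite /plateau b0 subr0 expr1n subrr.
Qed.

Lemma cvg_plateau t : a < t < b -> (fun n => plateau n t) @ \oo --> (1 : R).
Proof.
move=> h; rewrite -[X in _ --> X]subr0; apply: cvgB; first exact: cvg_cst.
have cv : (fun n => (1 - bump t) ^+ n) @ \oo --> (0 : R).
  apply: cvg_expr; rewrite ger0_norm ?subr_ge0 ?bump_le1//.
  by rewrite ltrBlDr ltrDl bump_gt0.
by move: cv; rewrite -(cvg_shiftn 2); under eq_fun do rewrite addn2.
Qed.

Lemma plateau_d n (t : R) :
  is_derive t 1 (plateau n) (n.+2%:R * (1 - bump t) ^+ n.+1 * bump1 t).
Proof. exact: is_derive_onem_pow (bump_d t). Qed.

Lemma plateau1_d n (t : R) :
  is_derive t 1 (fun s => n.+2%:R * (1 - bump s) ^+ n.+1 * bump1 s)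
   (n.+2%:R * ((1 - bump t) ^+ n.+1 * bump2 t - n.+1%:R * (1 - bump t) ^+ n * bump1 t ^+ 2)).
Proof. exact: is_derive_onem_pow1 (bump_d t) (bump1_d t). Qed.

Lemma plateau2_cont n : continuous (fun t =>
  n.+2%:R * ((1 - bump t) ^+ n.+1 * bump2 t - n.+1%:R * (1 - bump t) ^+ n * bump1 t ^+ 2)).
Proof.
have k (z : R) : continuous (fun _ : R => z) by move=> t; exact: cvg_cst.
have cb : continuous (fun t => 1 - bump t).
  by move=> t; apply: cvgB; [exact: k|exact: (is_derive_continuous bump_d)].
have cb1 := is_derive_continuous bump1_d.
apply: (contM (k n.+2%:R)) => t.
apply: cvgB; first exact: (contM (contX (n := n.+1) cb) bump2_cont).
exact: (contM (contM (k n.+1%:R) (contX (n := n) cb)) (contX (n := 2) cb1)).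
Qed.

Lemma plateau_cout n t : ~ (a <= t <= b) -> plateau n t = 0.
Proof. by move=> h; apply: plateau_out => /andP[h1 h2]; apply: h; rewrite !ltW. Qed.

Definition plateau_profile n : profile a b :=
  Profile (@plateau_cout n) (@plateau_d n) (@plateau1_d n) (@plateau2_cont n).

End profiles.

Section product_tests.
Context (R : realType) (n : nat).
Local Notation XT := (R * 'rV[R]_n)%type.

Lemma is_derive_on_line (V : normedModType R) (F : V -> R) (g : R -> R) (x v : V) (s0 d : R) :
  (forall s, F (s *: v + x) = g (s + s0)) -> is_derive s0 1 g d -> is_derive x v F d.
Proof.
move=> Fg [dg1 dg2].
have E : (fun h : R => h^-1 *: ((F \o shift x) (h *: v) - F x)) =
    (fun h : R => h^-1 *: ((g \o shift s0) (h *: 1) - g s0)).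
  apply/funext => h /=; rewrite Fg [h *: 1]mulr1.
  by have := Fg 0; rewrite scale0r !add0r => ->.
split; first by rewrite /derivable E.
by rewrite -dg2 /derive E.
Qed.

Lemma continuous_prod (I : Type) (r : seq I) (P : pred I) (F : I -> XT -> R) p :
  (forall i, {for p, continuous (F i)}) ->
  {for p, continuous (fun q => \prod_(i <- r | P i) F i q)}.
Proof.
move=> cF; rewrite /prop_for /continuous_at; elim: r => [|i r IH].
  by under eq_fun do rewrite big_nil; rewrite big_nil; exact: cvg_cst.
under eq_fun do rewrite big_cons; rewrite big_cons; case: ifP => // _.
by apply: cvgM => //; exact: cF.
Qed.

Variables (D : set XT) (a b : R) (u v : 'rV[R]_n).
Hypothesis QD : cbox a b u v `<=` D.
Variables (f f' : R -> R).
Hypothesis f_out : forall t, ~ (a <= t <= b) -> f t = 0.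
Hypothesis f_d : forall t : R, is_derive t 1 f (f' t).
Hypothesis f'_cont : continuous f'.
Variable g : forall i : 'I_n, profile (u 0 i) (v 0 i).

Let cone (h : R -> R) (ch : continuous h) i p :
  {for p, continuous (fun q : XT => h (q.2 0 i))}.
Proof.
apply: (@continuous_comp _ _ _ (fun q : XT => q.2 0 i) h); last exact: ch.
exact: continuous_snd_coor.
Qed.

Let cfst (h : R -> R) (ch : continuous h) p : {for p, continuous (fun q : XT => h q.1)}.
Proof.
apply: (@continuous_comp _ _ _ (fst : XT -> R) h); last exact: ch.
exact: cvg_fst.
Qed.

Let G (x : 'rV[R]_n) : R := \prod_i g i (x 0 i).
Let Gi i (x : 'rV[R]_n) : R := \prod_(j | j != i) g j (x 0 j).

Let gc i : continuous (g i). Proof. exact: is_derive_continuous (@pf_d _ _ _ (g i)). Qed.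
Let g1c i : continuous (pf1 (g i)).
Proof. exact: is_derive_continuous (@pf1_d _ _ _ (g i)). Qed.

Definition product_tf (p : XT) : R := f p.1 * G p.2.
Definition product_tf_t (p : XT) : R := f' p.1 * G p.2.
Definition product_tf_x i (p : XT) : R := f p.1 * (pf1 (g i) (p.2 0 i) * Gi i p.2).
Definition product_tf_xx i (p : XT) : R := f p.1 * (pf2 (g i) (p.2 0 i) * Gi i p.2).

Let product_out p : ~ cbox a b u v p -> product_tf p = 0.
Proof.
move=> np; rewrite /product_tf.
have [h1|/f_out ->] := pselect (a <= p.1 <= b); last by rewrite mul0r.
have [i hi] : exists i, ~ (u 0 i <= p.2 0 i <= v 0 i).
  by apply: contrapT => h; apply: np; split=> // i; apply: contrapT => hi; apply: h; exists i.
by rewrite /G (bigD1 i)//= pf_out// mul0r mulr0.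
Qed.

Let fc : continuous f. Proof. exact: is_derive_continuous f_d. Qed.

Let cG (p : XT) : {for p, continuous (fun q : XT => G q.2)}.
Proof. by apply: continuous_prod => i; exact: cone. Qed.

Let cGi i (p : XT) : {for p, continuous (fun q : XT => Gi i q.2)}.
Proof. by apply: continuous_prod => j; exact: cone. Qed.

Let line_coor (x : 'rV[R]_n) i (s : R) : (s *: delta_mx 0 i + x) 0 i = s + x 0 i.
Proof. by rewrite !mxE !eqxx mulr1. Qed.

Let line_Gi (x : 'rV[R]_n) i (s : R) : Gi i (s *: delta_mx 0 i + x) = Gi i x.
Proof.
apply: eq_bigr => j ji; rewrite !mxE eqxx/= (negbTE ji).
by rewrite mulr0 add0r.
Qed.

Let d_line (h h' : R -> R) i (t : R) x : (forall s : R, is_derive s 1 h (h' s)) ->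
  is_derive x (delta_mx 0 i) (fun y => f t * (h (y 0 i) * Gi i y))
    (f t * (h' (x 0 i) * Gi i x)).
Proof.
move=> dh; apply: (@is_derive_on_line _ _ (fun s => f t * (h s * Gi i x)) x _ (x 0 i)).
  by move=> s; rewrite line_coor line_Gi.
have := dh (x 0 i) => ?.
by apply: is_derive_eq; rewrite /GRing.scale /=; ring.
Qed.

(** The time factor carries a single derivative, which admits the hat primitives
    besides the plateaus. *)
Definition product_test : test_function D.
Proof.
refine (@TestFunction _ _ D product_tf product_tf_t product_tf_x product_tf_xx
  (cbox a b u v) (@compact_cbox _ _ _ _ _ _) QD product_out _ _ _ _ _ _ _).
- by move=> p; apply: cvgM; [exact: cfst|exact: cG].
- by move=> p; apply: cvgM; [exact: cfst|exact: cG].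
- by move=> i p; apply: cvgM; [exact: cfst|apply: cvgM; [exact: cone|exact: cGi]].
- move=> i p; apply: cvgM; [exact: cfst|apply: cvgM; [|exact: cGi]].
  by apply: cone; exact: pf2_cont.
- move=> t x; have h := is_deriveM (f_d t) (is_derive_cst (G x) t 1).
  by apply: (is_derive_eq h); rewrite /product_tf_t /GRing.scale /=; ring.
- move=> i t x; have := @d_line (g i) (pf1 (g i)) i t x (@pf_d _ _ _ (g i)).
  congr is_derive; apply/funext => y.
  by rewrite /product_tf /G (bigD1 i).
- by move=> i t x; exact: d_line (@pf1_d _ _ _ (g i)).
Defined.

Lemma product_test_tE p : tf_t product_test p = f' p.1 * \prod_i g i (p.2 0 i).
Proof. by []. Qed.

End product_tests.

(** * Density of the test functions *)

Section density.
Context (R : realType) (n : nat) (D : set (R * 'rV[R]_n)).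
Local Notation mu := (lebesgue_time_space R n).
Local Notation XT := (measurableTypeR R * 'rV[R]_n)%type.
Hypothesis oD : open D.

Definition plateau_box (a b : R) (u v : 'rV[R]_n) k (p : R * 'rV[R]_n) : R :=
  plateau a b k p.1 * \prod_i plateau (u 0 i) (v 0 i) k (p.2 0 i).

Variable h : XT -> R.
Hypothesis ih : mu.-integrable (D : set XT) (EFin \o h).
Hypothesis h0 : forall (a b : R) (u v : 'rV[R]_n) k, a < b -> (forall i, u 0 i < v 0 i) ->
  cbox a b u v `<=` D ->
  (\int[mu]_(p in (D : set XT)) (h p * plateau_box a b u v k p)%:E = 0)%E.

Let mD : measurable (D : set XT). Proof. exact: open_measurable_rV. Qed.

(** Dominated convergence of the plateaus to the indicator of the open box. *)
Lemma integral_box_eq0 a b u v : cbox a b u v `<=` D ->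
  (\int[mu]_(p in box a b u v) (h p)%:E = 0)%E.
Proof.
move=> QD.
have [ab|ba] := ltP a b; last first.
  rewrite (_ : box a b u v = set0) ?integral_set0// -subset0 => p [/andP[h1 h2] _].
  by have := lt_trans h1 h2; rewrite ltNge ba.
have [uv|] := pselect (forall i, u 0 i < v 0 i); last first.
  move=> /existsNP[i /negP]; rewrite -leNgt => vu.
  rewrite (_ : box a b u v = set0) ?integral_set0// -subset0 => p [_ /(_ i)/andP[h1 h2]].
  by have := lt_trans h1 h2; rewrite ltNge vu.
pose Psi k := product_test QD (@pf_out _ _ _ (plateau_profile a b k))
  (@pf_d _ _ _ (plateau_profile a b k))
  (is_derive_continuous (@pf1_d _ _ _ (plateau_profile a b k)))
  (fun i => plateau_profile (u 0 i) (v 0 i) k).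
have PsiE k p : Psi k p = plateau a b k p.1 * \prod_i plateau (u 0 i) (v 0 i) k (p.2 0 i).
  by [].
have QsD : box a b u v `<=` (D : set XT) by move=> p /sub_box_cbox; exact: QD.
have -> : (\int[mu]_(p in box a b u v) (h p)%:E =
    \int[mu]_(p in (D : set XT)) (h p * \1_(box a b u v) p)%:E)%E.
  rewrite [LHS]integral_mkcond [RHS]integral_mkcond; apply: eq_integral => p _.
  rewrite !patchE indicE; have [pQ|pQ] := boolP (p \in box a b u v).
    by rewrite mem_set ?mulr1//; apply: QsD; exact: set_mem.
  by rewrite mulr0; case: ifP.
have [mh _] := integrableP _ _ _ ih; have mh' := (measurable_EFinP _ _).1 mh.
have [] := @dominated_convergence _ _ _ mu (D : set XT) mD
  (fun k p => (h p * Psi k p)%:E) (fun p => (h p * \1_(box a b u v) p)%:E)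
  (fun p => `|h p|%:E).
- move=> k; apply/measurable_EFinP; apply: measurable_funM => //.
  by apply: (measurable_funS measurableT) => //; apply: continuous_measurable_rV;
    exact: (@tf_cont _ _ _ (Psi k)).
- apply/measurable_EFinP; apply: measurable_funM => //.
  by apply: measurable_indic; exact: measurable_box.
- apply: aeW => p _; apply: cvg_EFin; first by apply: nearW.
  apply: cvgM; first exact: cvg_cst.
  rewrite indicE; have [/set_mem[p1 p2]|pQ] := boolP (p \in box a b u v).
    rewrite -[X in _ --> X]mul1r; apply: cvgM; first exact: cvg_plateau.
    rewrite -[X in _ --> X](@big1_eq _ 1 *%R 'I_n (index_enum _) xpredT).
    elim: (index_enum _) => [|i r IH].
      by rewrite big_nil; under eq_fun do rewrite big_nil; exact: cvg_cst.
    rewrite big_cons; under eq_fun do rewrite big_cons.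
    by apply: cvgM => //; exact: cvg_plateau.
  have z k : Psi k p = 0.
    rewrite PsiE; have [p1|p1] := pselect (a < p.1 < b); last by rewrite plateau_out ?mul0r.
    have [i hi] : exists i, ~ (u 0 i < p.2 0 i < v 0 i).
      apply: contrapT => hh; move/negP: pQ; apply; apply/mem_set; split=> // i.
      by apply: contrapT => hi; apply: hh; exists i.
    by rewrite (bigD1 i)//= (plateau_out _ hi) mul0r mulr0.
  by under eq_fun do rewrite z; exact: cvg_cst.
- exact: integrable_norm.
- apply: aeW => p k _; rewrite (_ : `|_|%E = `|h p * Psi k p|%:E)// lee_fin.
  rewrite normrM ler_piMr// PsiE.
  rewrite ger0_norm; last first.
    rewrite mulr_ge0 ?(plateau_ge0 ab)// prodr_ge0// => i _.
    exact: plateau_ge0 (uv i) _ _.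
  rewrite mulr_ile1 ?(plateau_ge0 ab) ?(plateau_le1 ab)//.
    by rewrite prodr_ge0// => i _; exact: plateau_ge0 (uv i) _ _.
  by apply: prodr_ile1 => i _; rewrite (plateau_ge0 (uv i)) (plateau_le1 (uv i)).
move=> _ _ cv.
have E : (fun k => (\int[mu]_(p in (D : set XT)) (h p * Psi k p)%:E)%E) = (fun=> 0%E).
  by apply/funext => k; exact: (h0 k ab uv QD).
rewrite -(cvg_lim (@ereal_hausdorff R) cv) E; exact: lim_cst.
Qed.

(** Boxes form a pi-system generating the measurable sets. *)
Lemma integral_subset_box_eq0 a b u v (A : set XT) : cbox a b u v `<=` D ->
  measurable A -> (\int[mu]_(p in A `&` box a b u v) (h p)%:E = 0)%E.
Proof.
move=> QD; rewrite measurable_boxes; move: A.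
have mQ := measurable_box a b u v.
have iQ : mu.-integrable (box a b u v) (EFin \o h).
  by apply: integrableS ih => // p /sub_box_cbox; exact: QD.
have iS S : measurable S -> mu.-integrable (S `&` box a b u v) (EFin \o h).
  by move=> mS; apply: integrableS iQ => //; exact: measurableI.
apply: dynkin_induction.
- exact: measurable_boxes.
- exact: boxes_setI_closed.
- by rewrite setTI; exact: integral_box_eq0.
- move=> _ [a' [b' [u' [v' ->]]]]; rewrite boxI; apply: integral_box_eq0.
  move=> p [h1 h2]; apply: QD; move: h1; rewrite ge_max le_min.
  move=> /andP[/andP[_ h3] /andP[_ h4]]; split; first by rewrite h3.
  move=> i; have := h2 i; rewrite !mxE ge_max le_min.
  by move=> /andP[/andP[_ ->] /andP[_ ->]].
- move=> S mS IS.
  have QE : box a b u v = (~` S `&` box a b u v) `|` (S `&` box a b u v).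
    by rewrite -setIUl setvU setTI.
  have := integral_box_eq0 QD; rewrite {1}QE integral_setU_EFin.
  - by rewrite IS adde0.
  - by apply: measurableI => //; exact: measurableC.
  - exact: measurableI.
  - by rewrite -QE; apply/measurable_EFinP; case/integrableP: iQ.
  - by apply/disj_set2P; rewrite setIACA setICl set0I.
- move=> F mF tF IF; rewrite setI_bigcupl integral_bigcup.
  + by apply: eseries0 => i _ _; exact: IF.
  + exact: trivIset_setIr.
  + by move=> k; exact: measurableI.
  + by rewrite -setI_bigcupl; apply: iS; exact: bigcupT_measurable.
Qed.

(** Null integrals over the measurable subsets of a box force [h] to vanish
    there, and countably many boxes exhaust [D]. *)
Lemma plateau_orthogonal_ae0 : \forall p \ae mu, (D : set XT) p -> h p = 0.
Proof.
have [a [b [u [v [QD DE]]]]] := open_bigcup_box oD.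
have [mh _] := integrableP _ _ _ ih.
have N k : mu.-negligible [set p | box (a k) (b k) (u k) (v k) p /\ h p <> 0].
  have iQ : mu.-integrable (box (a k) (b k) (u k) (v k)) (EFin \o h).
    apply: integrableS ih => //; first exact: measurable_box.
    by move=> p /sub_box_cbox; exact: QD.
  have := @integral_ae_eq _ _ _ mu _ (measurable_box (a k) (b k) (u k) (v k)) (cst 0%E) _ iQ.
  move=> /(_ (measurable_cst _)) H.
  have {H} [E EQ mE|A [mA A0 sA]] := H.
    rewrite /= integral0 -(setIidl EQ).
    exact: integral_subset_box_eq0 (QD k) mE.
  by exists A; split=> // p [Qp hp]; apply: sA => /(_ Qp)/= [] /hp.
have : mu.-negligible (\bigcup_k [set p | box (a k) (b k) (u k) (v k) p /\ h p <> 0]).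
  exact: negligible_bigcup.
apply: negligibleS => p /= /not_implyP[Dp hp].
by move: Dp; rewrite DE => -[k _ Qp]; exists k.
Qed.

End density.

(** * Hat functions and the lemma of du Bois-Reymond *)

Section hats.
Context (R : realType).
Local Notation leb := (@lebesgue_measure R).
Implicit Types (x y t h : R).

(** The second difference of the positive part is a hat on [(x, x + 2h)], and
    [hat_primitive] is constant on both sides of it; the difference of two
    primitives is therefore compactly supported. *)
Definition hat x h t : R :=
  pospart (t - x) - 2 * pospart (t - x - h) + pospart (t - x - 2 * h).
Definition hat_primitive x h t : R :=
  2^-1 * (pospart (t - x) ^+ 2 - 2 * pospart (t - x - h) ^+ 2 + pospart (t - x - 2 * h) ^+ 2).

Lemma pospartE t : (0 <= t /\ pospart t = t) \/ (t <= 0 /\ pospart t = 0).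
Proof.
have [t0|/ltW t0] := leP 0 t; first by left; rewrite pospart_ge.
by right; rewrite pospart_le.
Qed.

Lemma hat_out x h t : 0 < h -> ~ (x < t < x + 2 * h) -> hat x h t = 0.
Proof.
move=> h0 /negP; rewrite negb_and -!leNgt /hat => /orP[tx|tx].
  by rewrite !pospart_le; lra.
by rewrite !pospart_ge; lra.
Qed.

Lemma hat_gt0 x h t : 0 < h -> x < t < x + 2 * h -> 0 < hat x h t.
Proof.
move=> h0 /andP[h1 h2]; rewrite /hat.
rewrite (@pospart_ge _ (t - x)); last lra.
rewrite (@pospart_le _ (t - x - 2 * h)); last lra.
by have [[h3 ->]|[h3 ->]] := pospartE (t - x - h); lra.
Qed.

Lemma hat_ge0_le x h t : 0 < h -> 0 <= hat x h t <= h.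
Proof.
move=> h0; rewrite /hat.
have [[h1 ->]|[h1 ->]] := pospartE (t - x);
have [[h2 ->]|[h2 ->]] := pospartE (t - x - h);
have [[h3 ->]|[h3 ->]] := pospartE (t - x - 2 * h); lra.
Qed.

Lemma hat_primitive_le x h t : 0 < h -> t <= x -> hat_primitive x h t = 0.
Proof. by move=> h0 tx; rewrite /hat_primitive !pospart_le ?expr0n/=; lra. Qed.

Lemma hat_primitive_ge x h t : 0 < h -> x + 2 * h <= t -> hat_primitive x h t = h ^+ 2.
Proof. by move=> h0 tx; rewrite /hat_primitive !pospart_ge; [field|lra..]. Qed.

Lemma continuous_hat x h : continuous (hat x h).
Proof.
have c z : continuous (fun t : R => pospart (t - z)).
  move=> t; apply: (@continuous_comp _ _ _ (fun s : R => s - z) (@pospart R)).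
    by apply: cvgB; [exact: cvg_id|exact: cvg_cst].
  exact: continuous_pospart.
have -> : hat x h = fun t => pospart (t - x) - 2 * pospart (t - (x + h)) +
    pospart (t - (x + 2 * h)) by apply/funext => t; rewrite /hat !opprD !addrA.
move=> t; apply: cvgD; last exact: c.
by apply: cvgB; [exact: c|apply: cvgM; [exact: cvg_cst|exact: c]].
Qed.

Lemma is_derive_hat_primitive x h t : is_derive t 1 (hat_primitive x h) (hat x h t).
Proof.
have d z : is_derive t 1 (fun s => pospart (s - z) ^+ 2) (2 * pospart (t - z)).
  have := @is_derive1_comp R (fun s => pospart s ^+ 2) (fun s => s - z) t _ _
    (is_derive_pospartX 0 (t - z)).
  have e := is_deriveB (is_derive_id t (1 : R)) (is_derive_cst z t (1 : R)).
  by move=> /(_ _ e); rewrite subr0 mulr1 expr1.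
have k (z : R) := is_derive_cst z t (1 : R).
have := is_deriveM (k 2^-1) (is_deriveD (is_deriveB (d x)
  (is_deriveM (k 2) (d (x + h)))) (d (x + 2 * h))).
have -> : hat_primitive x h = (cst 2^-1 : R -> R) * (((fun s => pospart (s - x) ^+ 2) -
   (cst 2 : R -> R) * (fun s => pospart (s - (x + h)) ^+ 2)) +
   (fun s => pospart (s - (x + 2 * h)) ^+ 2)).
  apply/funext => s; rewrite /hat_primitive.
  by rewrite -[RHS]/(2^-1 * (pospart (s - x) ^+ 2 - 2 * pospart (s - (x + h)) ^+ 2 +
    pospart (s - (x + 2 * h)) ^+ 2)) !opprD !addrA.
move=> H; apply: (is_derive_eq H).
by rewrite /GRing.scale /= !mulr0 !addr0 /hat !opprD !addrA; field.
Qed.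

Definition hat_test x y h t : R := hat_primitive x h t - hat_primitive y h t.

Lemma hat_test_out x y h t : 0 < h -> x <= y -> ~ (x <= t <= y + 2 * h) ->
  hat_test x y h t = 0.
Proof.
move=> h0 xy /negP; rewrite negb_and -!ltNge /hat_test => /orP[tx|tx].
  by rewrite !hat_primitive_le ?subrr//; lra.
by rewrite !hat_primitive_ge ?subrr//; lra.
Qed.

Lemma is_derive_hat_test x y h t :
  is_derive t 1 (hat_test x y h) (hat x h t - hat y h t).
Proof. exact: is_deriveB (is_derive_hat_primitive x h t) (is_derive_hat_primitive y h t). Qed.

Lemma continuous_hatB x y h : continuous (fun t => hat x h t - hat y h t).
Proof. by move=> t; apply: cvgB; exact: continuous_hat. Qed.

Variable (T : R) (T0 : 0 < T).
Let I : set (measurableTypeR R) := `]0, T[%classic.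

Lemma integral_hatB x y h : 0 < h -> 0 < x -> x <= y -> y + 2 * h < T ->
  \int[leb]_(t in I) (hat x h t - hat y h t) = 0.
Proof.
move=> h0 x0 xy yT; rewrite /Rintegral.
have o (t : R) : ~ I t -> hat x h t - hat y h t = 0.
  rewrite /I /= in_itv /= => /negP; rewrite negb_and -!leNgt => tI.
  by rewrite !hat_out ?subrr//; move=> /andP[? ?]; move: tI => /orP[]; lra.
rewrite integral_mkcond.
rewrite (_ : _ \_ I = fun t => (hat x h t - hat y h t)%:E); last first.
  by apply/funext => t; rewrite patchE; case: ifPn => // /negP; rewrite inE => /o ->.
rewrite (@integral_derivative0 _ (hat_test x y h) _ T T0 (is_derive_hat_test x y h))//.
- exact: continuous_hatB.
- move=> s hs; have nI : ~ I s.
    rewrite /I /= in_itv /= => /andP[s0 sT]; move: hs; rewrite ger0_norm; lra.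
  split; last exact: o.
  by apply: hat_test_out => // /andP[? ?]; apply: nI; rewrite /I /= in_itv /=; lra.
Qed.

(** Suppose [c x0 <> 0].  With one narrow hat placed at [x0] and the other close
    to [T], where [c] is small, the integrand
    [(sg (c x0) c - |c x0| / 2) (hat x0 - hat y)] is nonnegative and its integral
    is zero, although it is positive on the first hat. *)
Lemma hat_orthogonal_ae0 (rho c : R -> R) :
  leb.-integrable I (EFin \o rho) -> {within `[0, T], continuous c} -> c T = 0 ->
  rho = c %[ae leb in I] ->
  (forall x y h, 0 < h -> 0 < x -> x < y -> y + 2 * h < T ->
     \int[leb]_(t in I) (rho t * (hat x h t - hat y h t)) = 0) ->
  rho = (fun=> 0) %[ae leb in I].
Proof.
move=> irho cc cT rc rho0.
suff c0 x0 : I x0 -> c x0 = 0.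
  by apply: filterS rc => t + It => /(_ It) ->; exact: c0.
move=> Ix0; apply: contrapT => cx0.
pose sg : R := Num.sg (c x0).
pose d : R := sg * c x0 / 2.
have d0 : 0 < d by rewrite /d /sg -normrEsg divr_gt0// normr_gt0; apply/eqP.
have [x00 x0T] : 0 < x0 /\ x0 < T by move: Ix0; rewrite /I /= in_itv => /andP.
have cE (z : R) : 0 <= z <= T -> exists2 e, 0 < e &
    forall t, 0 <= t <= T -> `|t - z| < e -> `|sg * c t - sg * c z| < d.
  move=> zT; have /subspace_continuousP/(_ z) := cc.
  rewrite /= in_itv => /(_ zT) /cvgrPdist_lt/(_ _ d0); rewrite near_withinE.
  move=> /nbhs_ballP[e /= e0 he]; exists e => // t tT tz.
  have : `|c z - c t| < d by apply: he; rewrite /= ?in_itv//= /ball /= distrC.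
  rewrite -mulrBr normrM distrC; apply: le_lt_trans.
  by rewrite ler_piMl// normr_sg; case: eqP.
have [e1 e10 he1] := cE x0 ltac:(by rewrite !ltW).
have [e2 e20 he2] := cE T ltac:(by rewrite ltW/=).
have [h [h0 h1 h2 h3]] : exists h : R, [/\ 0 < h, 2 * h < e1, 3 * h < e2 & 5 * h < T - x0].
  pose m := Num.min e1 (Num.min e2 (T - x0)).
  have m0 : 0 < m by rewrite !lt_min e10 e20 subr_gt0.
  have [m1 m2 m3] : [/\ m <= e1, m <= e2 & m <= T - x0].
    by rewrite /m !ge_min !lexx !orbT.
  exists (m / 6); split; lra.
(* the second hat lives on (T - 3h, T - h), away from T itself *)
pose y := T - 3 * h.
have xy : x0 + 2 * h < y by rewrite /y; lra.
have yT : y + 2 * h < T by rewrite /y; lra.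
have xy' : x0 < y by lra.
pose hats t := hat x0 h t - hat y h t.
have mhats : measurable_fun I hats.
  by apply: measurable_funS (continuous_measurable_fun (@continuous_hatB x0 y h)).
have bhats : [bounded hats t | t in I].
  exists h; split; first exact: num_real.
  move=> M hM t _; apply: le_trans (ltW hM); rewrite /hats /=.
  have := hat_ge0_le x0 t h0; have := hat_ge0_le y t h0 => /andP[? ?] /andP[? ?].
  by rewrite ler_norml; apply/andP; split; lra.
have mI : measurable I by exact: measurable_itv.
have Ioo : (leb I < +oo)%E by rewrite /I lebesgue_measure_itv /= lte_fin T0 ltry.
have ihats : leb.-integrable I (EFin \o hats) by exact: measurable_bounded_integrable.
have irh : leb.-integrable I (EFin \o (fun t => rho t * hats t)).
  by have := integrableMl mI irho mhats bhats; apply: eq_integrable.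
pose F t := (sg * rho t - d) * hats t.
have FE t : F t = sg * (rho t * hats t) - d * hats t by rewrite /F mulrBl mulrA.
have iF : leb.-integrable I (EFin \o F).
  have := integrableB mI (integrableZl mI sg irh) (integrableZl mI d ihats).
  by apply: eq_integrable => // t _; rewrite /= FE.
have IF : (\int[leb]_(t in I) (F t)%:E = 0)%E.
  have H := RintegralB mI (integrableZl mI sg irh) (integrableZl mI d ihats).
  have : \int[leb]_(t in I) F t = 0.
    transitivity (\int[leb]_(t in I) (sg * (rho t * hats t) - d * hats t)).
      by apply: eq_Rintegral => t _; exact: FE.
    rewrite H !RintegralZl// rho0// integral_hatB// ?mulr0 ?subrr//; exact: ltW.
  rewrite /Rintegral => h4; rewrite -[LHS]fineK ?h4//.
  exact: integrable_fin_num iF.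
have F0 : \forall t \ae leb, I t -> 0 <= F t /\ (x0 < t < x0 + 2 * h -> 0 < F t).
  apply: filterS rc => t + It => /(_ It) rct; rewrite /F rct /hats.
  have [t0 tT] : 0 < t /\ t < T by move: It; rewrite /I /= in_itv => /andP.
  have t0T : 0 <= t <= T by rewrite !ltW.
  have pos : x0 < t < x0 + 2 * h -> 0 < (sg * c t - d) * (hat x0 h t - hat y h t).
    move=> tx; have hp := hat_gt0 h0 tx; have /andP[tx1 tx2] := tx.
    rewrite (@hat_out y)//; last by move=> /andP[? ?]; lra.
    have t2 : `|t - x0| < e1 by rewrite ger0_norm; lra.
    have := he1 t t0T t2; rewrite ltr_norml /d => /andP[h4 _].
    by rewrite subr0 mulr_gt0// /d; lra.
  split=> //; have [/pos/ltW//|tx] := pselect (x0 < t < x0 + 2 * h).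
  rewrite (@hat_out x0)// sub0r.
  have [ty|ty] := pselect (y < t < y + 2 * h); last by rewrite hat_out// oppr0 mulr0.
  have hp := hat_gt0 h0 ty; have /andP[ty1 ty2] := ty.
  have t2 : `|t - T| < e2 by rewrite ler0_norm; move: ty1; rewrite /y; lra.
  have := he2 t t0T t2; rewrite cT mulr0 subr0 ltr_norml => /andP[_ h4].
  by rewrite mulrN -mulNr mulr_ge0 ?(ltW hp)//; lra.
have F00 : \forall t \ae leb, I t -> F t = 0.
  have mF := measurable_int _ iF.
  have IaF : (\int[leb]_(t in I) `|(F t)%:E| = 0)%E.
    rewrite -[RHS]IF; apply: ae_eq_integral => //; first exact: measurableT_comp.
    by apply: filterS F0 => t + It => /(_ It)[Ft _]; rewrite gee0_abs ?lee_fin.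
  have := (ae_eq_integral_abs leb mI mF).1 IaF.
  by apply: filterS => t + It => /(_ It)/= [].
have : leb.-negligible (`]x0, x0 + 2 * h[%classic : set (measurableTypeR R)).
  apply: (negligibleS _ (filterI F0 F00)) => t /=; rewrite in_itv /= => tx [].
  have It : I t by rewrite /I /= in_itv /=; move: tx => /andP[? ?]; apply/andP; split; lra.
  by move=> /(_ It)[_ /(_ tx)] Ft /(_ It); apply/eqP; rewrite gt_eqF.
move=> N0; have := (negligibleP leb (measurable_itv _)).1 N0.
have := @lebesgue_measure_itv R `]x0, x0 + 2 * h[; rewrite /= => ->.
by rewrite lte_fin ltrDl mulr_gt0// -EFinD => -[]; lra.
Qed.

End hats.

(** * Uniqueness and linearity of the weak operator *)

Section weak_solutions.
Context (R : realType) (n : nat) (T : R) (Omega : set 'rV[R]_n).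
Hypotheses (oO : open Omega) (bO : bounded_set Omega).
Local Notation leb := (@lebesgue_measure R).
Local Notation lebx := (lebesgue_rV R n).
Local Notation mu := (lebesgue_time_space R n).
Local Notation XT := (measurableTypeR R * 'rV[R]_n)%type.
Local Notation D := (cylinder T Omega).
Let mD : measurable (D : set XT) := measurable_cylinder T oO.
Let Doo : (mu (D : set XT) < +oo)%E := cylinder_lty T oO bO.

Definition plateau_test a b u v k (QD : cbox a b u v `<=` D) : test_function D :=
  product_test QD (@pf_out _ _ _ (plateau_profile a b k))
    (@pf_d _ _ _ (plateau_profile a b k))
    (is_derive_continuous (@pf1_d _ _ _ (plateau_profile a b k)))
    (fun i => plateau_profile (u 0 i) (v 0 i) k).

Lemma L2_orthogonal_ae0 (h : XT -> R[i]) : L2 mu D h ->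
  (forall Psi : test_function D, L2dot mu D h (toC Psi) = 0) ->
  h = (fun=> 0) %[ae mu in D].
Proof.
move=> Lh h0; have [Lr Li] := (L2P mu mD h).1 Lh.
have H k a b u v (QD : cbox a b u v `<=` D) :
    (\int[mu]_(p in D) (Re (h p) * plateau_box a b u v k p)%:E = 0)%E /\
    (\int[mu]_(p in D) (Im (h p) * plateau_box a b u v k p)%:E = 0)%E.
  pose Psi := plateau_test k QD.
  have [i1 i2] := L2_cintegrable mD Lh (L2_test oO bO Psi).
  have := h0 Psi; rewrite /L2dot /cintegral => -[e1 e2]; split.
    have <- : (\int[mu]_(p in D) (Re (h p * (toC Psi p)^*%C))%:E = 0)%E.
      by rewrite -[LHS]fineK ?(integrable_fin_num _ i1)//; congr EFin.
    by apply: eq_integral => p _; rewrite !partsE /= oppr0 mulr0 subr0.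
  have <- : (\int[mu]_(p in D) (Im (h p * (toC Psi p)^*%C))%:E = 0)%E.
    by rewrite -[LHS]fineK ?(integrable_fin_num _ i2)//; congr EFin.
  by apply: eq_integral => p _; rewrite !partsE /= oppr0 mulr0 add0r.
have Hr := plateau_orthogonal_ae0 (open_cylinder oO) (real_L2_integrable mD Doo Lr)
  (fun a b u v k _ _ QD => (H k a b u v QD).1).
have Hi := plateau_orthogonal_ae0 (open_cylinder oO) (real_L2_integrable mD Doo Li)
  (fun a b u v k _ _ QD => (H k a b u v QD).2).
apply: filterS2 Hr Hi => p + + Dp => /(_ Dp) + /(_ Dp).
by case: (h p) => x y /= -> ->.
Qed.

Context (V : XT -> R) (LV : Linfty mu D V).
Local Notation weak := (weak_Sstar T Omega V).

(** Closability of [S0^*]: the weak identity determines its right-hand side. *)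
Lemma weak_Sstar_unique v w w' : weak v w -> weak v w' -> w = w' %[ae mu in D].
Proof.
move=> [Lv Lw hw] [_ Lw' hw'].
have : (fun p => - 1 * w' p + w p) = (fun=> 0) %[ae mu in D].
  apply: L2_orthogonal_ae0; first exact: L2_lin.
  move=> Psi; rewrite L2dot_lin//; last exact: L2_test.
  by rewrite hw hw' mulN1r addNr.
apply: filterS => p + Dp => /(_ Dp)/eqP; rewrite mulN1r addrC subr_eq0 => /eqP.
exact.
Qed.

Lemma weak_Sstar_lin (c : R[i]) v w v' w' : weak v w -> weak v' w' ->
  weak (fun p => c * v p + v' p) (fun p => c * w p + w' p).
Proof.
move=> [Lv Lw hw] [Lv' Lw' hw']; split; [exact: L2_lin..|] => Psi.
rewrite !L2dot_lin//; [by rewrite hw hw'|exact: L2_schrodinger_test|exact: L2_test].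
Qed.

Lemma weak_Sstar_ae0 v w : weak v w -> v = (fun=> 0) %[ae mu in D] ->
  w = (fun=> 0) %[ae mu in D].
Proof.
move=> [Lv Lw hw] v0; apply: L2_orthogonal_ae0 => // Psi.
have LP := L2_schrodinger_test oO bO LV Psi.
by rewrite hw L2dot_ae0.
Qed.

(** For real [w] the imaginary part of [i w_t + w_xx / 2 - V w = 0] leaves only
    the time derivative. *)
Lemma weak_Sstar_real0 (w : XT -> R) z : weak (toC w) z -> z = (fun=> 0) %[ae mu in D] ->
  forall Psi : test_function D, \int[mu]_(p in D) (w p * tf_t Psi p) = 0.
Proof.
move=> [Lw Lz hz] z0 Psi.
have LP := L2_test oO bO Psi; have LS := L2_schrodinger_test oO bO LV Psi.
have : L2dot mu D (toC w) (schrodinger_test V Psi) = 0 by rewrite -hz L2dot_ae0.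
have [_ i2] := L2_cintegrable mD Lw LS.
rewrite /L2dot /cintegral => -[_ e2].
rewrite -[RHS](mulr0 (-1)) -[in RHS]e2 -RintegralZl//.
by apply: eq_Rintegral => p _; ring.
Qed.

End weak_solutions.

(** * Tensor products *)

Section product_integral.
Context (R : realType) (n : nat) (T : R) (Omega : set 'rV[R]_n).
Local Notation leb := (@lebesgue_measure R).
Local Notation lebx := (lebesgue_rV R n).
Local Notation mu := (lebesgue_time_space R n).
Local Notation XT := (measurableTypeR R * 'rV[R]_n)%type.
Let I : set (measurableTypeR R) := `]0, T[%classic.
Local Notation D := (cylinder T Omega).
Hypothesis mO : measurable Omega.
Let mD : measurable (D : set XT).
Proof. by apply: measurableX => //; exact: measurable_itv. Qed.

Section tensor.
Variables (a : R -> R) (b : 'rV[R]_n -> R).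
Hypotheses (ia : leb.-integrable I (EFin \o a)) (ib : lebx.-integrable Omega (EFin \o b)).
Let A := a \_ I.
Let B := b \_ Omega.

Let iA : leb.-integrable setT (EFin \o A).
Proof.
have mI : measurable I by exact: measurable_itv.
by rewrite /A -restrict_EFin; apply/(integrable_mkcond _ mI).
Qed.

Let iB : lebx.-integrable setT (EFin \o B).
Proof. by rewrite /B -restrict_EFin; apply/(integrable_mkcond _ mO). Qed.

Let tensorE : (fun p : XT => a p.1 * b p.2) \_ D = fun p => A p.1 * B p.2.
Proof.
apply/funext => p; rewrite /A /B !patchE /D /cylinder in_setX.
by case: (p.1 \in I); case: (p.2 \in Omega); rewrite ?mul0r ?mulr0.
Qed.

Let EB (f : 'rV[R]_n -> R) z : lebx.-integrable setT (EFin \o f) ->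
  (\int[lebx]_x (z * f x)%:E = (z * \int[lebx]_x f x)%:E)%E.
Proof.
move=> jf; have jz := integrableZl measurableT z jf.
rewrite -RintegralZl// /Rintegral fineK//; exact: integrable_fin_num jz.
Qed.

Let iAB : mu.-integrable setT (fun p : XT => (A p.1 * B p.2)%:E).
Proof.
have mA := (measurable_EFinP _ _).1 (measurable_int _ iA).
have mB := (measurable_EFinP _ _).1 (measurable_int _ iB).
have mAB : measurable_fun setT (fun p : XT => (A p.1 * B p.2)%:E).
  apply/measurable_EFinP; apply: measurable_funM.
    exact: (measurableT_comp mA measurable_fst).
  exact: (measurableT_comp mB measurable_snd).
apply/(integrable12ltyP leb lebx mAB).
have inB := integrable_norm iB; have inA := integrable_norm iA.
under eq_integral => t _.
  under eq_integral => x _ do rewrite /= normrM.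
  rewrite (@EB (fun x => `|B x|))//; over.
rewrite /=.
have := integrableZr measurableT (\int[lebx]_x `|B x|) inA.
by move=> /(integrable_lty measurableT).
Qed.

Lemma integrable_tensor : mu.-integrable D (EFin \o (fun p : XT => a p.1 * b p.2)).
Proof. by apply/(integrable_mkcond _ mD); rewrite restrict_EFin tensorE. Qed.

Lemma Rintegral_tensor :
  \int[mu]_(p in D) (a p.1 * b p.2) = \int[leb]_(t in I) a t * \int[lebx]_(x in Omega) b x.
Proof.
rewrite (Rintegral_mkcond leb I) (Rintegral_mkcond lebx Omega) (Rintegral_mkcond mu D).
rewrite tensorE {1}/Rintegral -(integral12_prod_meas1 iAB) /=.
rewrite -RintegralZr// /Rintegral; congr fine.
by apply: eq_integral => t _; rewrite /fubini_F; have := @EB B (A t) iB.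
Qed.

End tensor.

End product_integral.

Section tensor_products.
Context (R : realType) (n : nat) (T : R) (Omega : set 'rV[R]_n).
Hypotheses (T0 : 0 < T) (oO : open Omega) (bO : bounded_set Omega).
Local Notation leb := (@lebesgue_measure R).
Local Notation lebx := (lebesgue_rV R n).
Local Notation mu := (lebesgue_time_space R n).
Local Notation XT := (measurableTypeR R * 'rV[R]_n)%type.
Let I : set (measurableTypeR R) := `]0, T[%classic.
Local Notation D := (cylinder T Omega).
Let mD : measurable (D : set XT) := measurable_cylinder T oO.
Let mI : measurable I. Proof. exact: measurable_itv. Qed.
Let Ioo : (leb I < +oo)%E.
Proof. by rewrite /I lebesgue_measure_itv /= lte_fin T0 ltry. Qed.

Lemma open_measurable_rV1 : measurable Omega.
Proof.
have o : open (snd @^-1` Omega : set (R * 'rV[R]_n)).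
  by apply: open_comp => [p _|//]; exact: cvg_snd.
have mp : measurable_fun setT (fun x : 'rV[R]_n => (0 : measurableTypeR R, x)).
  exact: pair1_measurable.
by have := mp measurableT _ (open_measurable_rV o); rewrite setTI.
Qed.

Lemma bounded_lty_rV : (lebx Omega < +oo)%E.
Proof.
have [M [_ hM]] := bO.
apply: le_lt_trans (cube_rV_lty R n (Num.bound (`|M| + 1))).
apply: le_measure; rewrite ?inE.
- exact: open_measurable_rV1.
- exact: measurable_cube_rV.
move=> x Ox i; rewrite /= in_itv /= -ltr_norml.
have s0 : 0 <= `|M| + 1 by rewrite addr_ge0.
apply: le_lt_trans (archi_boundP s0); rewrite (le_trans (ler_coor _ _))// hM//.
by rewrite (le_lt_trans (ler_norm _))// ltrDl.
Qed.

Let mO := open_measurable_rV1.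

Lemma measurable_plateau a b k : measurable_fun setT (plateau a b k : measurableTypeR R -> R).
Proof.
apply: continuous_measurable_fun.
exact: is_derive_continuous (@pf_d _ _ _ (plateau_profile a b k)).
Qed.

Lemma integrable_plateau a b k : a < b -> leb.-integrable I (EFin \o plateau a b k).
Proof.
move=> ab; apply: measurable_bounded_integrable => //.
  by apply: measurable_funS (measurable_plateau a b k).
exists 1; split; first exact: num_real.
move=> M M1 t _; rewrite /= ger0_norm ?(plateau_ge0 ab)//.
exact: le_trans (plateau_le1 ab _ _) (ltW M1).
Qed.

Definition plateau_rV (u v : 'rV[R]_n) k (x : 'rV[R]_n) : R :=
  \prod_i plateau (u 0 i) (v 0 i) k (x 0 i).

Lemma integrable_plateau_rV (b : 'rV[R]_n -> R) (u v : 'rV[R]_n) k :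
  (forall i, u 0 i < v 0 i) -> lebx.-integrable Omega (EFin \o b) ->
  lebx.-integrable Omega (EFin \o (fun x => b x * plateau_rV u v k x)).
Proof.
move=> uv ib; have mP : measurable_fun Omega (plateau_rV u v k).
  apply: measurable_prod => i _.
  apply: (measurable_funS measurableT) => //.
  apply: (measurableT_comp (measurable_plateau _ _ _)).
  exact: measurable_coor.
have bP : [bounded plateau_rV u v k x | x in Omega].
  exists 1; split; first exact: num_real.
  move=> M M1 x _; rewrite /= ger0_norm; last first.
    by apply: prodr_ge0 => i _; exact: plateau_ge0 (uv i) _ _.
  apply: le_trans (ltW M1); apply: prodr_ile1 => i _.
  by rewrite (plateau_ge0 (uv i)) (plateau_le1 (uv i)).
by have := integrableMl mO ib mP bP; apply: eq_integrable.
Qed.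

(** Testing with a product of a function of time and a plateau, Fubini splits
    the orthogonality relation into two factors, one of which must vanish for
    all tests. *)
Lemma tensor_orthogonal_ae0 (rho : R -> R) (phi : 'rV[R]_n -> R) :
  H1T T rho -> L2 lebx Omega (toC phi) ->
  (forall Psi : test_function D, \int[mu]_(p in D) (rho p.1 * phi p.2 * tf_t Psi p) = 0) ->
  rho = (fun=> 0) %[ae leb in I] \/ phi = (fun=> 0) %[ae lebx in Omega].
Proof.
move=> [/(L2P _ mI)[Lrho _] _ [c [cc rc cT]]] /(L2P _ mO)[Lphi _] H.
have irho : leb.-integrable I (EFin \o rho) by exact: real_L2_integrable Lrho.
have iphi : lebx.-integrable Omega (EFin \o phi).
  by apply: real_L2_integrable Lphi => //; exact: bounded_lty_rV.
have [?|nphi] := pselect (phi = (fun=> 0) %[ae lebx in Omega]); first by right.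
left; apply: (hat_orthogonal_ae0 T0 irho cc cT rc) => x y h h0 x0 xy yT.
apply: contrapT => kappa; apply: nphi.
have irh : leb.-integrable I (EFin \o (fun t => rho t * (hat x h t - hat y h t))).
  have mh : measurable_fun I (fun t => hat x h t - hat y h t).
    by apply: measurable_funS (continuous_measurable_fun (@continuous_hatB R x y h)).
  have bh : [bounded hat x h t - hat y h t | t in I].
    exists h; split; first exact: num_real.
    move=> M hM t _; apply: le_trans (ltW hM); rewrite /=.
    have := hat_ge0_le x t h0; have := hat_ge0_le y t h0 => /andP[? ?] /andP[? ?].
    by rewrite ler_norml; apply/andP; split; lra.
  by have := integrableMl mI irho mh bh; apply: eq_integrable.
have phi0 k (a b : R) (u v : 'rV[R]_n) :
    (forall i, u 0 i < v 0 i) -> a < b -> cbox a b u v `<=` D ->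
    \int[lebx]_(x in Omega) (phi x * plateau_rV u v k x) = 0.
  move=> uv ab QD.
  have QD' : cbox x (y + 2 * h) u v `<=` D.
    move=> p [/andP[p1 p2] p3]; split.
      by rewrite /= in_itv /=; apply/andP; split; lra.
    by have [] // := QD (a, p.2); split; rewrite //= lexx ltW.
  pose Psi := product_test QD' (fun t => @hat_test_out _ x y h t h0 (ltW xy))
    (is_derive_hat_test x y h) (@continuous_hatB R x y h)
    (fun i => plateau_profile (u 0 i) (v 0 i) k).
  have := Rintegral_tensor mO irh (integrable_plateau_rV k uv iphi).
  rewrite (_ : \int[mu]_(p in D) _ = 0); last first.
    rewrite -[RHS](H Psi); apply: eq_Rintegral => p _.
    by rewrite product_test_tE /plateau_rV; ring.
  by move/esym/eqP; rewrite mulf_eq0 => /orP[/eqP//|/eqP].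
have i1 : leb.-integrable I (EFin \o (fun=> 1 : R)).
  apply: measurable_bounded_integrable => //.
  by exists 1; split; [exact: num_real|move=> M M1 t _; rewrite /= normr1 ltW].
have iphiD : mu.-integrable D (EFin \o (fun p => phi p.2)).
  have := integrable_tensor mO i1 iphi.
  by apply: eq_integrable => // p _ /=; rewrite mul1r.
have phiD0 := plateau_orthogonal_ae0 (open_cylinder oO) iphiD.
have {}phiD0 : \forall p \ae mu, D p -> phi p.2 = 0.
  apply: phiD0 => a b u v k ab uv QD.
  have ip := integrable_plateau k ab; have iq := integrable_plateau_rV k uv iphi.
  have := Rintegral_tensor mO ip iq; have := integrable_tensor mO ip iq.
  rewrite (phi0 k a b u v)// mulr0 => it E0.
  transitivity (\int[mu]_(p in D) (plateau a b k p.1 * (phi p.2 * plateau_rV u v k p.2))%:E)%E.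
    by apply: eq_integral => p _; congr EFin; rewrite /plateau_box /plateau_rV mulrCA.
  by rewrite -[LHS]fineK ?(integrable_fin_num _ it)//; congr EFin.
have inphi := integrable_norm iphi.
have Iphi : \int[lebx]_(x in Omega) `|phi x| = 0.
  have E1 := Rintegral_tensor mO i1 inphi.
  have E2 : \int[mu]_(p in D) (1 * `|phi p.2|) = 0.
    have [m1 _] := integrableP _ _ _ (integrable_tensor mO i1 inphi).
    rewrite /Rintegral (ae_eq_integral (cst 0%E))//; first by rewrite integral_cst// mul0e.
    by apply: filterS phiD0 => p + Dp => /(_ Dp) -> /=; rewrite normr0 mulr0.
  move: E1; rewrite E2 => /esym/eqP; rewrite mulf_eq0 => /orP[|/eqP//].
  rewrite Rintegral_cst// mul1r; have := @lebesgue_measure_itv R `]0, T[.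
  rewrite /= lte_fin T0 -EFinD subr0 => ->.
  by rewrite /= gt_eqF.
have mphi := measurable_int _ iphi.
have Iphi' : (\int[lebx]_(x in Omega) `|(phi x)%:E| = 0)%E.
  by rewrite -[LHS]fineK ?(integrable_fin_num _ inphi)//; congr EFin.
have := (ae_eq_integral_abs lebx mO mphi).1 Iphi'.
by apply: filterS => z + Oz => /(_ Oz)/= [].
Qed.

End tensor_products.

(** * The Petrov-Galerkin problem *)

Section galerkin.
Context (R : realType) (n : nat) (T : R) (Omega : set 'rV[R]_n).
Context (V : R * 'rV[R]_n -> R) (Nt Nh : nat) (rho : 'I_Nt -> R -> R)
  (phi : 'I_Nh -> 'rV[R]_n -> R).
Local Notation mu := (lebesgue_time_space R n).
Local Notation XT := (measurableTypeR R * 'rV[R]_n)%type.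
Local Notation D := (cylinder T Omega).
Hypotheses (oO : open Omega) (bO : bounded_set Omega).
Hypothesis LV : Linfty mu D V.
Hypothesis conforming : Vdelta rho phi `<=` Vspace T Omega V.
Let mD : measurable (D : set XT) := measurable_cylinder T oO.
Local Notation Sst := (Sstar T Omega V).
Local Notation weak := (weak_Sstar T Omega V).
Implicit Types (u v : XT -> R[i]).

(** [Sstar] selects one limit; the weak identity is the property common to all
    of them. *)
Lemma Sstar_weak v : Vdelta rho phi v -> weak v (Sst v).
Proof.
by move=> /conforming vw; apply: closureS_weak => //; exact: xgetPex vw.
Qed.

Lemma L2_Sstar v : Vdelta rho phi v -> L2 mu D (Sst v).
Proof. by move=> /Sstar_weak[]. Qed.

Lemma Vdelta_lin (a : R[i]) v v' : Vdelta rho phi v -> Vdelta rho phi v' ->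
  Vdelta rho phi (fun p => a * v p + v' p).
Proof.
move=> [c ->] [c' ->]; exists (a *: c + c'); apply/funext => p.
rewrite mulr_sumr -big_split; apply: eq_bigr => k _.
rewrite mulr_sumr -big_split; apply: eq_bigr => i _.
by rewrite !mxE mulrDl mulrA.
Qed.

Lemma Vdelta0 : Vdelta rho phi (fun=> 0).
Proof.
exists 0; apply/funext => p; rewrite big1// => k _; rewrite big1// => i _.
by rewrite mxE mul0r.
Qed.

Lemma Vdelta_tensor k i : Vdelta rho phi (toC (fun p => rho k p.1 * phi i p.2)).
Proof.
exists (delta_mx k i); apply/funext => p.
rewrite (bigD1 k)//= (bigD1 i)//= big1 ?addr0; last first.
  by move=> i' ii; rewrite mxE (negbTE ii) andbF mul0r.
rewrite big1 ?addr0; last first.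
  by move=> k' kk; rewrite big1// => i' _; rewrite mxE (negbTE kk) mul0r.
by rewrite mxE !eqxx mul1r.
Qed.

(** The selection of a limit need not be linear, but the weak form is linear and
    determines the selected function. *)
Lemma Sstar_lin (a : R[i]) v v' : Vdelta rho phi v -> Vdelta rho phi v' ->
  Sst (fun p => a * v p + v' p) = (fun p => a * Sst v p + Sst v' p) %[ae mu in D].
Proof.
move=> Vv Vv'; apply: (weak_Sstar_unique oO bO (Sstar_weak (Vdelta_lin a Vv Vv'))).
by apply: weak_Sstar_lin => //; exact: Sstar_weak.
Qed.

Let m := #|{: 'I_Nt * 'I_Nh}|.
Let e (j : 'I_m) : XT -> R[i] :=
  toC (fun p => rho (enum_val j).1 p.1 * phi (enum_val j).2 p.2).

Let Vdelta_comb s c : Vdelta rho phi (comb s e c).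
Proof.
elim: s => [|j s IH]; first by rewrite comb_nil; exact: Vdelta0.
by rewrite comb_cons; apply: Vdelta_lin => //; exact: Vdelta_tensor.
Qed.

Let VdeltaE v : Vdelta rho phi v -> exists c, v = comb (index_enum _) e c.
Proof.
move=> [c ->]; exists (fun j => c (enum_val j).1 (enum_val j).2); apply/funext => p.
rewrite pair_bigA /= /comb.
rewrite (eq_bigl (fun x : 'I_Nt * 'I_Nh => x \in {: 'I_Nt * 'I_Nh}))//.
by rewrite big_enum_val.
Qed.

Let w j := Sst (e j).
Let Lw j : L2 mu D (w j). Proof. exact/L2_Sstar/Vdelta_tensor. Qed.

Lemma weak_Sstar0 : weak (fun=> 0) (fun=> 0).
Proof.
split; [exact: L2_0..|] => Psi.
rewrite !L2dot_ae0//; try exact: ae_eq_refl; try exact: L2_0.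
- exact: L2_schrodinger_test.
- exact: L2_test.
Qed.

Let Sstar_comb s c : Sst (comb s e c) = comb s w c %[ae mu in D].
Proof.
apply: (weak_Sstar_unique oO bO (Sstar_weak (Vdelta_comb s c))).
elim: s => [|j s IH]; first by rewrite !comb_nil; exact: weak_Sstar0.
rewrite !comb_cons; apply: weak_Sstar_lin => //.
exact/Sstar_weak/Vdelta_tensor.
Qed.

Section functional.
Variables (g : (XT -> R[i]) -> R[i]) (Vg : Vdual T Omega V g).

Let g_comb s c : g (comb s e c) = \sum_(j <- s) (c j)^*%C * g (e j).
Proof.
have [gl _] := Vg; elim: s => [|j s IH].
  rewrite comb_nil big_nil.
  have := gl (-1) _ _ (conforming Vdelta0) (conforming Vdelta0).
  under [X in g X]eq_fun do rewrite mulr0 addr0.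
  by rewrite rmorphN rmorph1 mulN1r addNr.
rewrite comb_cons big_cons gl ?IH//; apply: conforming => //.
exact: Vdelta_tensor.
Qed.

(** A representation theorem in the span of finitely many, possibly dependent,
    vectors; boundedness of [g] makes its values compatible with their relations. *)
Lemma petrov_galerkin_exists : exists u, petrov_galerkin T Omega V rho phi g u.
Proof.
have [gl [C gC]] := Vg.
have [c hc] : exists c, forall k, L2dot mu D (comb (index_enum _) w c) (w k) = g (e k).
  apply: gram_solve => // c c0; rewrite -g_comb; apply: Normc.eq0_normc.
  apply/le_anti; rewrite normc_ge0 andbT.
  have := gC _ (conforming (Vdelta_comb (index_enum _) c)).
  rewrite /Vnorm /Unorm /L2norm.
  have Lc := L2_comb mD Lw (index_enum _) c.
  have LS := L2_Sstar (Vdelta_comb (index_enum _) c).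
  rewrite (ae_eq_L2dot mD LS Lc LS Lc (Sstar_comb _ c) (Sstar_comb _ c)).
  by rewrite -/(L2norm _ _ _) c0 mulr0.
exists (comb (index_enum _) w c); split.
  split; first exact: L2_comb.
  exists (comb (index_enum _) e c) => //.
  exact/ae_eq_sym/Sstar_comb.
move=> v /VdeltaE[b ->]; rewrite /bform.
have Lc := L2_comb mD Lw (index_enum _) c; have Lb := L2_comb mD Lw (index_enum _) b.
have LS := L2_Sstar (Vdelta_comb (index_enum _) b).
rewrite (ae_eq_L2dot mD Lc Lc LS Lb _ (Sstar_comb _ b)); last exact: ae_eq_refl.
rewrite L2dot_combr// g_comb; apply: eq_bigr => j _.
by rewrite hc.
Qed.

(** The difference of two solutions is itself the image of a test function, so
    it is orthogonal to itself. *)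
Lemma petrov_galerkin_unique u u' : petrov_galerkin T Omega V rho phi g u ->
  petrov_galerkin T Omega V rho phi g u' -> eqU T Omega u' u.
Proof.
move=> [[Lu [v Vv uv]] hu] [[Lu' [v' Vv' uv']] hu'].
pose z := fun p => - 1 * v p + v' p; have Vz : Vdelta rho phi z := Vdelta_lin (-1) Vv Vv'.
pose x := fun p => - 1 * u p + u' p; have Lx : L2 mu D x := L2_lin mD (-1) Lu Lu'.
have xz : Sst z = x %[ae mu in D].
  have := Sstar_lin (-1) Vv Vv'; rewrite -/z => H.
  near=> p => Dp; have -> : Sst z p = - 1 * Sst v p + Sst v' p.
    by move: Dp; near: p; exact: H.
  rewrite /x; congr (_ * _ + _); move: Dp; near: p.
    by apply: filterS uv => p h /h.
  by apply: filterS uv' => p h /h.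
have x0 : L2dot mu D x x = 0.
  rewrite -(ae_eq_L2dot mD Lx Lx (L2_Sstar Vz) Lx (ae_eq_refl _ _ _) xz).
  rewrite L2dot_lin//; last exact: L2_Sstar.
  have := hu z Vz; have := hu' z Vz; rewrite /bform => -> ->.
  by rewrite mulN1r addNr.
have xn : L2norm mu D x = 0.
  by move: x0; rewrite L2dot_self => -[/eqP]; rewrite sqrf_eq0 => /eqP.
have := L2norm0_ae mD Lx xn; apply: filterS => p + Dp => /(_ Dp).
by rewrite /x mulN1r addrC => /eqP; rewrite subr_eq0 => /eqP.
Unshelve. all: by end_near. Qed.

End functional.

(** The function whose image is [u] attains the bound of Cauchy-Schwarz. *)
Lemma sup_ratio u : Udelta T Omega V rho phi u -> ~ eqU T Omega u (fun=> 0) ->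
  ereal_sup [set (normc (bform T Omega V u v) / (Unorm T Omega u * Vnorm T Omega V v))%:E |
     v in Vdelta rho phi `&` [set v | ~ eqU T Omega v (fun=> 0)]] = 1%E.
Proof.
move=> [Lu [v Vv uv]] nu; have LS := L2_Sstar Vv.
have u0 : 0 < L2norm mu D u.
  rewrite lt0r L2norm_ge0 andbT; apply/eqP => un; apply: nu.
  exact: L2norm0_ae.
apply/eqP; rewrite eq_le; apply/andP; split.
  apply: ge_ereal_sup => _ [v' [Vv' _] <-]; rewrite lee_fin.
  have := cauchy_schwarz mD Lu (L2_Sstar Vv').
  rewrite -/(bform T Omega V u v') /Vnorm /Unorm => cs.
  have [n0|n0] := eqVneq (L2norm mu D (Sst v')) 0.
    by rewrite n0 mulr0 invr0 mulr0.
  by rewrite ler_pdivrMr ?mul1r// mulr_gt0// lt0r n0 L2norm_ge0.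
apply: ereal_sup_ubound; exists v.
  split=> // v0; apply: nu.
  have S0 := weak_Sstar_ae0 oO bO LV (Sstar_weak Vv) v0.
  by apply: filterS2 uv S0 => p h1 h2 Dp; rewrite h1// h2.
have Lr := ae_eq_refl mu D u.
rewrite /bform /Vnorm /Unorm (ae_eq_L2dot mD Lu Lu LS Lu Lr (ae_eq_sym uv)).
have -> : L2norm mu D (Sst v) = L2norm mu D u.
  by rewrite /L2norm (ae_eq_L2dot mD LS Lu LS Lu (ae_eq_sym uv) (ae_eq_sym uv)).
rewrite L2dot_self /= expr0n/= addr0 sqrtr_sqr ger0_norm ?sqr_ge0//.
by rewrite -expr2 divff// sqrf_eq0 gt_eqF.
Qed.

End galerkin.

Lemma ae_free_neq0 d (X : measurableType d) (R : realType)
    (mu : {measure set X -> \bar R}) (D : set X) m (f : 'I_m -> X -> R) :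
  (forall a : 'I_m -> R, (fun x => \sum_(k < m) a k * f k x) = (fun=> 0) %[ae mu in D] ->
     forall k, a k = 0) ->
  forall k, ~ f k = (fun=> 0) %[ae mu in D].
Proof.
move=> free k fk0; have : (k == k)%:R = 0 :> R.
  apply: (free (fun j => (j == k)%:R)); apply: filterS fk0 => x h Dx.
  rewrite (bigD1 k)//= eqxx mul1r h// add0r big1// => j /negbTE ->.
  by rewrite mul0r.
by rewrite eqxx => /eqP; rewrite oner_eq0.
Qed.

Theorem proposition3p1 (R : realType) (N : nat) (T : R)
    (Omega : set 'rV[R]_(3 * N)) (V : R * 'rV[R]_(3 * N) -> R)
    (Nt Nh : nat) (rho : 'I_Nt -> R -> R)
    (phi : 'I_Nh -> 'rV[R]_(3 * N) -> R)
    (N_ge1 : (1 <= N)%N) (T_gt0 : 0 < T)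
    (Omega_domain : bounded_domain Omega)
    (Omega_smooth : smooth_boundary Omega)
    (V_bounded : Linfty (lebesgue_time_space R (3 * N)) (cylinder T Omega) V)
    (Nt_ge1 : (1 <= Nt)%N) (Nh_ge1 : (1 <= Nh)%N)
    (rho_basis : temporal_basis T rho)
    (phi_basis : spatial_basis Omega phi)
    (conforming : Vdelta rho phi `<=` Vspace T Omega V) :
  beta_delta T Omega V rho phi = 1%E /\
  forall g, Vdual T Omega V g ->
    exists u, petrov_galerkin T Omega V rho phi g u /\
      forall u', petrov_galerkin T Omega V rho phi g u' -> eqU T Omega u' u.
Proof.
have [oO _ _ bO] := Omega_domain; split; last first.
  move=> g Vg; have [u hu] := petrov_galerkin_exists oO bO V_bounded conforming Vg.
  exists u; split=> // u' hu'.
  exact: (petrov_galerkin_unique oO bO V_bounded conforming hu hu').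
(* one nonzero element of U_delta keeps the infimum from being +oo *)
pose k0 := Ordinal Nt_ge1; pose i0 := Ordinal Nh_ge1.
have Vv := Vdelta_tensor rho phi k0 i0; set v := toC _ in Vv.
have [LS nz] : L2 (lebesgue_time_space R (3 * N)) (cylinder T Omega) (Sstar T Omega V v) /\
    ~ eqU T Omega (Sstar T Omega V v) (fun=> 0).
  have wv := Sstar_weak oO bO V_bounded conforming Vv; split; first by case: wv.
  move=> S0; have [Hrho _ rho_free] := rho_basis.
  have [_ Hphi phi_free] := phi_basis; have [[Lphi _] _] := Hphi i0.
  have [r0|p0] := tensor_orthogonal_ae0 T_gt0 oO bO (Hrho k0) Lphi
    (weak_Sstar_real0 oO bO V_bounded wv S0).
    exact: ae_free_neq0 rho_free k0 r0.
  exact: ae_free_neq0 phi_free i0 p0.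
rewrite /beta_delta (_ : [set _ | _ in _] = [set 1%E]) ?ereal_inf1//.
apply/seteqP; split=> [_ [u [Uu nu] <-]|_ ->].
  exact: sup_ratio.
exists (Sstar T Omega V v); last first.
  apply: sup_ratio => //.
  by split=> //; exists v => //; exact: ae_eq_refl.
by split=> //; split=> //; exists v => //; exact: ae_eq_refl.
Qed.
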